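(* Let $Z$ be an abelian group, let $\mathcal{A}=\bigoplus_{k\in Z}\mathcal{A}_k$ be a $Z$-graded unital associative algebra over $\mathbb{C}$, and let $M=\bigoplus_{n\in Z}M_n$ be a $Z$-graded-simple quasifinite $\mathcal{A}$-module. Let $\widehat G$ be a finite abelian group of automorphisms of $\mathcal{A}$ preserving the $Z$-grading, and let $\widehat H$ be the subgroup of those $\sigma\in\widehat G$ for which there is a $Z$-grading-preserving isomorphism of $\mathcal{A}$-modules $M\cong M^\sigma$. Let $G=\mathrm{Hom}(\widehat G,\mathbb{C}^* )$, $H=\mathrm{Hom}(\widehat H,\mathbb{C}^* )$, and let $\psi:G\to H$ be the epimorphism given by restriction to $\widehat H$. Then: (i) $\rho_{nk}(\mathcal{A}^G_{k-n,g})=\rho_{nk}(\mathcal{A}^H_{k-n,\psi(g)})$ for all $g\in G$ and $n,k\in Z$. (ii) There is a bijective correspondence between thin $G$-coverings of $M$ and thin $H$-coverings of $M$: given a thin $H$-covering $\{M^H_h\mid h\in H\}$, one gets a thin $G$-covering $\{M^G_g\mid g\in G\}$ with $M^G_g:=M^H_{\psi(g)}$, and every thin $G$-covering of $M$ is of this form. (iii) All graded-simple $\mathcal{A}$-modules $\bigoplus_{g\in G}M_g$ (external direct sum) associated with the various thin $G$-coverings $\{M_g\mid g\in G\}$ of $M$ are isomorphic as graded modules, up to shifts in the $G$-gradings on the modules.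
   Context: Modules are left modules. A $Z$-graded module is quasifinite if all its graded components are finite-dimensional; $Z$-graded-simple means it has no proper nonzero $Z$-graded submodule. An automorphism $\sigma$ of $\mathcal{A}$ preserves the $Z$-grading if $\sigma(\mathcal{A}_k)=\mathcal{A}_k$ for all $k\in Z$. If $\rho$ is the action on $M$, then $M^\sigma$ is the $Z$-graded module on the space $M$ with action $\rho\circ\sigma$. For $n,k\in Z$, $\rho_{nk}:\mathcal{A}_{k-n}\to\mathrm{Hom}_{\mathbb{C}}(M_n,M_k)$ is the restriction of the action of $\mathcal{A}_{k-n}$ to $M_n$. The groups $G,H$ are written additively: $(g+h)(\sigma)=g(\sigma)h(\sigma)$. For $k\in Z$, $g\in G$, $h\in H$: $\mathcal{A}^G_{k,g}=\{a\in\mathcal{A}_k\mid\sigma(a)=g(\sigma)a\ \forall\sigma\in\widehat G\}$ and $\mathcal{A}^H_{k,h}=\{a\in\mathcal{A}_k\mid\sigma(a)=h(\sigma)a\ \forall\sigma\in\widehat H\}$; $\mathcal{A}^G_g=\bigoplus_k\mathcal{A}^G_{k,g}$ and $\mathcal{A}^H_h=\bigoplus_k\mathcal{A}^H_{k,h}$. For $F\in\{G,H\}$, an $F$-covering of $M$ is a family $\{M_f\mid f\in F\}$ of $Z$-graded subspaces that span $M$ and satisfy $\rho(\mathcal{A}^F_f)M_{f'}\subseteq M_{f+f'}$ for all $f,f'\in F$. It is thin if whenever $\{N_f\}$ is an $F$-covering of $M$ with $N_f\subseteq M_f$ for all $f$, then $N_f=M_f$ for all $f$. For a thin $G$-covering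 $\{M_g\}$, the external direct sum $\widetilde M=\bigoplus_{g\in G}M_g$ is a graded $\mathcal{A}$-module with $G$-components $\widetilde M_g=M_g$ (each $Z$-graded) and $\mathcal{A}^G_g$ mapping $\widetilde M_h=M_h$ to $\widetilde M_{g+h}=M_{g+h}$ by the action on $M$. *)

(* Defs.v *)
From HB Require Import structures.
From mathcomp Require Import all_boot all_order all_fingroup all_algebra all_solvable all_field all_character.
From mathcomp Require Import complex.
From mathcomp Require Import boolp classical_sets functions reals.

Set Implicit Arguments.
Unset Strict Implicit.
Unset Printing Implicit Defensive.

Import Order.TTheory GRing.Theory Num.Theory.

Local Open Scope classical_set_scope.
Local Open Scope ring_scope.

Section Subspaces.

(* [sc] is the scalar multiplication: the same definition serves for C-subspaces
   of an algebra, for C-subspaces of a module and for submodules *)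
Definition subspace (K : Type) (V : zmodType) (sc : K -> V -> V) (S : set V) : Prop :=
  [/\ S 0, forall x y, S x -> S y -> S (x + y) & forall c x, S x -> S (sc c x)].

Definition sum_set (I : Type) (V : zmodType) (W : I -> set V) : set V :=
  [set v | exists s : seq I, exists2 x : I -> V,
             forall i, W i (x i) & v = \sum_(i <- s) x i].

Definition direct_decomposition (I : choiceType) (V : zmodType) (W : I -> set V) : Prop :=
  (forall v, sum_set W v) /\
  (forall (s : seq I) (x : I -> V), uniq s -> (forall i, W i (x i)) ->
     \sum_(i <- s) x i = 0 -> forall i, i \in s -> x i = 0).

Lemma subspace_sum (K : Type) (V : zmodType) (sc : K -> V -> V) (S : set V) :
  subspace sc S -> forall (I : Type) (s : seq I) (P : pred I) (x : I -> V),
  (forall i, P i -> S (x i)) -> S (\sum_(i <- s | P i) x i).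
Proof. by case=> S0 SD _ I s P x Sx; apply: big_ind. Qed.

End Subspaces.

Section Graded.

Variables (C : numClosedFieldType) (Z : zmodType).

(* that the unit lies in degree 0 is a consequence of these axioms *)
Record gradedAlgebra := GradedAlgebra {
  galg :> algType C;
  gcomp : Z -> set galg;
  gcomp_subspace : forall k, subspace *:%R (gcomp k);
  gcomp_direct : direct_decomposition gcomp;
  gcompM : forall j k a b, gcomp j a -> gcomp k b -> gcomp (j + k) (a * b) }.

Arguments gcomp A k : rename, clear implicits.

Definition cscale (A : algType C) (M : lmodType A) (c : C) (m : M) : M :=
  c%:A *: m.

Record gradedModule (A : gradedAlgebra) := GradedModule {
  gmod :> lmodType A;
  mcomp : Z -> set gmod;
  mcomp_subspace : forall n, subspace (@cscale A gmod) (mcomp n);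
  mcomp_direct : direct_decomposition mcomp;
  mcompZ : forall k n (a : A) m,
    gcomp A k a -> mcomp n m -> mcomp (k + n) (a *: m) }.

Arguments mcomp {A} M n : rename.

Section GradedModules.

Variable A : gradedAlgebra.

Definition is_graded (M : gradedModule A) (N : set M) : Prop :=
  N `<=` sum_set (fun n => N `&` mcomp M n).

(* the zero module is not excluded *)
Definition graded_simple (M : gradedModule A) : Prop :=
  forall N : set M, subspace (fun (a : A) m => a *: m) N -> is_graded N ->
    N = [set 0] \/ N = setT.

Definition quasifinite (M : gradedModule A) : Prop :=
  forall n, exists d : nat, exists e : 'I_d -> M,
    mcomp M n = [set m | exists c : 'I_d -> C, m = \sum_i cscale (c i) (e i)].

Definition graded_iso (M N : gradedModule A) : Prop :=
  exists2 phi : {linear M -> N},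
    bijective phi & forall n, phi @` mcomp M n = mcomp N n.

Lemma shift_direct (M : gradedModule A) (s : Z) :
  direct_decomposition (fun n => mcomp M (n + s)).
Proof.
case: (mcomp_direct M) => sp ind; split=> [m | r x ur xM x0 n nr].
  have [r [x xM ->]] := sp m; exists [seq n - s | n <- r], (fun n => x (n + s)) => //.
  by rewrite big_map; apply: eq_bigr => n _; rewrite subrK.
rewrite -(addrK s n).
apply: (ind [seq n + s | n <- r] (fun n => x (n - s))); last exact: map_f.
- by rewrite map_inj_uniq //; apply: addIr.
- by move=> i; have := xM (i - s); rewrite subrK.
- by rewrite big_map -[RHS]x0; apply: eq_bigr => i _; rewrite addrK.
Qed.

Definition shift (s : Z) (M : gradedModule A) : gradedModule A.
Proof.
refine (@GradedModule A M (fun n => mcomp M (n + s)) _ (shift_direct M s) _).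
  by move=> n; apply: mcomp_subspace.
by move=> k n a m Aa Mm; rewrite -addrA; apply: mcompZ.
Defined.

(* the module M^sigma: the space M with the action a.m := sigma(a) m *)
Definition twist (sigma : {lrmorphism A -> A}) (M : lmodType A) : Type := M.

Section Twist.

Variables (sigma : {lrmorphism A -> A}) (M : lmodType A).

HB.instance Definition _ := GRing.Zmodule.copy (twist sigma M) M.

Let twscale (a : A) (m : twist sigma M) : twist sigma M := (sigma a *: (m : M)).

Let twscaleA a b m : twscale a (twscale b m) = twscale (a * b) m.
Proof. by rewrite /twscale rmorphM scalerA. Qed.

Let twscale1 : left_id 1 twscale.
Proof. by move=> m; rewrite /twscale rmorph1 scale1r. Qed.

Let twscaleDr : right_distributive twscale +%R.
Proof. by move=> a m n; rewrite /twscale -scalerDr. Qed.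

Let twscaleDl m : {morph twscale^~ m : a b / a + b}.
Proof. by move=> a b; rewrite /twscale rmorphD scalerDl. Qed.

HB.instance Definition _ :=
  GRing.Zmodule_isLmodule.Build A (twist sigma M) twscaleA twscale1 twscaleDr twscaleDl.

Lemma twist_scaleE (a : A) (m : twist sigma M) : a *: m = (sigma a *: (m : M)) :> M.
Proof. by []. Qed.

Lemma twist_cscaleE (c : C) (m : twist sigma M) : cscale c m = cscale c (m : M) :> M.
Proof. by rewrite /cscale twist_scaleE linearZ rmorph1. Qed.

End Twist.

Definition twisted_module (sigma : {lrmorphism A -> A})
    (pres : forall k, sigma @` gcomp A k = gcomp A k) (M : gradedModule A) :
  gradedModule A.
Proof.
refine (@GradedModule A (twist sigma M) (mcomp M) _ (mcomp_direct M) _).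
  move=> n; have [M0 MD MZ] := mcomp_subspace M n; split=> // c m Mm.
  by rewrite twist_cscaleE; apply: MZ.
move=> k n a m Aa Mm; rewrite twist_scaleE; apply: mcompZ => //.
by rewrite -pres; exists a.
Defined.

End GradedModules.

End Graded.

Arguments gcomp {C Z} A k : rename.
Arguments mcomp {C Z A} M n : rename.

Section Dual.

Variables (C : numClosedFieldType) (K : finGroupType).

(* Hom(K, C^* ), with its group law written additively *)
Record dual := Dual {
  dual_val :> {ffun K -> C};
  dual_valP : [forall x, dual_val x != 0] &&
              [forall x, forall y, dual_val (x * y)%g == dual_val x * dual_val y] }.

HB.instance Definition _ := [isSub for dual_val].
HB.instance Definition _ := [Choice of dual by <:].

Lemma dualP (f g : dual) : f =1 g -> f = g.
Proof. by move=> fg; apply/val_inj/ffunP. Qed.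

Lemma dual_neq0 (f : dual) x : f x != 0.
Proof. by case: f => /= f /andP[/forallP/(_ x)]. Qed.

Lemma dualM (f : dual) x y : f (x * y)%g = f x * f y.
Proof. by case: f => /= f /andP[_ /forallP/(_ x)/forallP/(_ y)/eqP]. Qed.

Lemma dual1 (f : dual) : f 1%g = 1.
Proof. by apply: (mulfI (dual_neq0 f 1%g)); rewrite -dualM mulg1 mulr1. Qed.

Lemma dual_proof (f : K -> C) : (forall x, f x != 0) ->
  (forall x y, f (x * y)%g = f x * f y) ->
  [forall x, (finfun f) x != 0] &&
  [forall x, forall y, (finfun f) (x * y)%g == (finfun f) x * (finfun f) y].
Proof.
move=> f0 fM; apply/andP; split; first by apply/forallP => x; rewrite ffunE.
by apply/forallP => x; apply/forallP => y; rewrite !ffunE fM.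
Qed.

Definition mkdual f f0 fM : dual := Dual (@dual_proof f f0 fM).

Lemma mkdualE f f0 fM x : @mkdual f f0 fM x = f x.
Proof. by rewrite ffunE. Qed.

Lemma dual_one_neq0 (x : K) : (fun=> 1 : C) x != 0.
Proof. exact: oner_neq0. Qed.

Lemma dual_one_mul (x y : K) : (fun=> 1 : C) (x * y)%g = 1 * 1.
Proof. by rewrite mulr1. Qed.

Lemma dual_mul_neq0 (f g : dual) x : f x * g x != 0.
Proof. by rewrite mulf_neq0 ?dual_neq0. Qed.

Lemma dual_mul_mul (f g : dual) x y :
  f (x * y)%g * g (x * y)%g = (f x * g x) * (f y * g y).
Proof. by rewrite !dualM mulrACA. Qed.

Lemma dual_inv_neq0 (f : dual) x : (f x)^-1 != 0.
Proof. by rewrite invr_neq0 ?dual_neq0. Qed.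

Lemma dual_inv_mul (f : dual) x y : (f (x * y)%g)^-1 = (f x)^-1 * (f y)^-1.
Proof. by rewrite dualM invfM. Qed.

Definition dual_zero : dual := mkdual dual_one_neq0 dual_one_mul.
Definition dual_add (f g : dual) : dual := mkdual (dual_mul_neq0 f g) (dual_mul_mul f g).
Definition dual_opp (f : dual) : dual := mkdual (dual_inv_neq0 f) (dual_inv_mul f).

Let dual_addA : associative dual_add.
Proof. by move=> f g h; apply: dualP => x; rewrite !mkdualE mulrA. Qed.

Let dual_addC : commutative dual_add.
Proof. by move=> f g; apply: dualP => x; rewrite !mkdualE mulrC. Qed.

Let dual_add0 : left_id dual_zero dual_add.
Proof. by move=> f; apply: dualP => x; rewrite !mkdualE mul1r. Qed.

Let dual_addN : left_inverse dual_zero dual_opp dual_add.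
Proof. by move=> f; apply: dualP => x; rewrite !mkdualE mulVf ?dual_neq0. Qed.

HB.instance Definition _ :=
  GRing.isZmodule.Build dual dual_addA dual_addC dual_add0 dual_addN.

Lemma dual0E x : (0 : dual) x = 1.
Proof. exact: mkdualE. Qed.

Lemma dualDE (f g : dual) x : (f + g) x = f x * g x.
Proof. exact: mkdualE. Qed.

Lemma dualNE (f : dual) x : (- f) x = (f x)^-1.
Proof. exact: mkdualE. Qed.

Lemma dualX (f : dual) x n : f (x ^+ n)%g = f x ^+ n.
Proof. by elim: n => [|n IH]; rewrite ?dual1 // expgS exprS dualM IH. Qed.

Lemma roots_of_unity_proof : exists rs : seq C, ('X^#|K| - 1) = \prod_(z <- rs) ('X - z%:P).
Proof.
have [rs Drs] := closed_field_poly_normal ('X^#|K| - 1 : {poly C}).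
exists rs; rewrite {1}Drs (monicP _) ?scale1r // monicXnsubC //.
by rewrite -cardsT cardG_gt0.
Qed.

Definition unity_roots : seq C := sval (cid roots_of_unity_proof).

Lemma unity_rootsE z : (z \in unity_roots) = (z ^+ #|K| == 1).
Proof.
rewrite -root_prod_XsubC /unity_roots; case: cid => rs /= <-.
by rewrite rootE !hornerE subr_eq0.
Qed.

Lemma dual_unity (f : dual) x : f x \in unity_roots.
Proof. by rewrite unity_rootsE -dualX -cardsT expg_cardG ?inE // dual1. Qed.

Definition dual_code (f : dual) : {ffun K -> seq_sub unity_roots} :=
  [ffun x => SeqSub (dual_unity f x)].

Definition dual_decode (u : {ffun K -> seq_sub unity_roots}) : option dual :=
  insub [ffun x => ssval (u x)].

Lemma dual_codeK : pcancel dual_code dual_decode.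
Proof.
move=> f; rewrite /dual_decode; have -> : [ffun x => ssval (dual_code f x)] = val f.
  by apply/ffunP => x; rewrite !ffunE.
by rewrite valK.
Qed.

HB.instance Definition _ := PCanIsCountable dual_codeK.
HB.instance Definition _ : isFinite dual := PCanIsFinite dual_codeK.

Lemma sum_dual (f : dual) : \sum_x f x = if f == 0 then #|K|%:R else 0.
Proof.
case: eqP => [->|f0].
  by under eq_bigr do rewrite dual0E; rewrite sumr_const.
have [y fy] : exists y, f y != 1.
  apply: contrapT => nfy; apply: f0; apply: dualP => x; rewrite dual0E.
  by apply/eqP/negPn/negP => fx; apply: nfy; exists x.
have : (f y - 1) * \sum_x f x = 0.
  rewrite mulrBl mul1r mulr_sumr; apply/eqP; rewrite subr_eq0; apply/eqP.
  rewrite [RHS](reindex_inj (mulgI y)).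
  by apply: eq_bigr => x _; rewrite dualM.
by move/eqP; rewrite mulf_eq0 subr_eq0 (negPf fy) => /eqP.
Qed.

Hypothesis abK : abelian [set: K]%SET.

Lemma dual_separates (x : K) : x != 1%g -> exists f : dual, f x != 1.
Proof.
move=> x1; have [i xi] : exists i : Iirr [set: K]%G, x \notin cfker ('chi_i)%R.
  apply: contrapT => nx; case/negP: x1.
  have : x \in (1%g : {set K}).
    rewrite -(TI_cfker_irr [set: K]%G).
    by apply/bigcapP => i _; apply/negPn/negP => xi; apply: nx; exists i.
  by rewrite inE.
set n := #|[set: K]%G|; have n_gt0 : (0 < n)%N by apply: cardG_gt0.
have lini : 'chi_i \is a linear_char by move/char_abelianP: abK.
have [z prz] := C_prim_root_exists n_gt0.
have [w prw] : exists w : C, n.-primitive_root w.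
  case: roots_of_unity_proof => rs; rewrite -[#|K|]cardsT -/n => Drs.
  have rs1 : all n.-unity_root rs by apply/allP => u; rewrite -root_prod_XsubC -Drs.
  have sz : (n < (size rs).+1)%N by rewrite -(size_prod_XsubC rs id) -Drs size_XnsubC.
  have [|w] := hasP (has_prim_root n_gt0 rs1 _ sz); last by exists w.
  by rewrite -separable_prod_XsubC -Drs separable_Xn_sub_1 // pnatr_eq0 -lt0n.
have chin y : 'chi_i y ^+ n = 1.
  by rewrite -lin_charX ?inE // expg_cardG ?inE // lin_char1.
have /choice[e eP] : forall y, exists k : nat, 'chi_i y = z ^+ k.
  by move=> y; have [k] := prim_rootP prz (chin y); exists k.
have w0 : w != 0.
  apply: contra_eq_neq (prim_expr_order prw) => ->.
  by rewrite expr0n gtn_eqF // eq_sym oner_neq0.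
have e0 y : w ^+ e y != 0 by rewrite expf_neq0.
have eM y y' : w ^+ e (y * y')%g = w ^+ e y * w ^+ e y'.
  rewrite -exprD; apply/eqP; rewrite (eq_prim_root_expr prw).
  by rewrite -(eq_prim_root_expr prz) -eP exprD -!eP lin_charM ?inE.
exists (mkdual e0 eM); rewrite mkdualE.
apply: contra xi; rewrite -(prim_order_dvd prw) (prim_order_dvd prz) -eP => /eqP xi1.
by rewrite cfkerEirr inE xi1 lin_char1.
Qed.

Lemma sum_over_dual_neq1 (x : K) : x != 1%g -> \sum_(f : dual) f x = 0.
Proof.
case/dual_separates=> g gx; have : (g x - 1) * \sum_(f : dual) f x = 0.
  rewrite mulrBl mul1r mulr_sumr; apply/eqP; rewrite subr_eq0; apply/eqP.
  by rewrite [RHS](reindex_inj (addrI g)); apply: eq_bigr => f _; rewrite dualDE.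
by move/eqP; rewrite mulf_eq0 subr_eq0 (negPf gx) => /eqP.
Qed.

Lemma card_dual : #|{: dual}| = #|K|.
Proof.
have S1 : \sum_(f : dual) \sum_x f x = #|K|%:R.
  under eq_bigr do rewrite sum_dual.
  by rewrite -big_mkcond /= big_pred1_eq.
have S2 : \sum_(f : dual) \sum_x f x = #|{: dual}|%:R.
  rewrite exchange_big (bigD1 1%g) //= [X in _ + X]big1 ?addr0.
    by under eq_bigr do rewrite dual1; rewrite sumr_const.
  by move=> x x1; apply: sum_over_dual_neq1.
by apply/eqP; rewrite -(eqr_nat C) -S1 S2.
Qed.

Lemma sum_over_dual (x : K) : \sum_(f : dual) f x = if x == 1%g then #|K|%:R else 0.
Proof.
case: eqP => [->|/eqP x1].
  by under eq_bigr do rewrite dual1; rewrite sumr_const card_dual.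
exact: sum_over_dual_neq1.
Qed.

End Dual.

Arguments dual C K%_type : clear implicits.

Section Coverings.

Variables (C : numClosedFieldType) (Z : zmodType) (A : gradedAlgebra C Z).

(* a finite abelian group of automorphisms of A preserving the grading, given as
   a faithful action of an abstract finite group *)
Record autGroup (K : finGroupType) := AutGroup {
  aut :> K -> {lrmorphism A -> A};
  aut_abelian : abelian [set: K]%SET;
  autM : forall x y a, aut (x * y)%g a = aut x (aut y a);
  aut_inj : forall x y, aut x =1 aut y -> x = y;
  aut_gcomp : forall x k, aut x @` gcomp A k = gcomp A k }.

Lemma aut1 (K : finGroupType) (s : autGroup K) a : s 1%g a = a.
Proof.
have sK b : s 1%g (s 1%g b) = s 1%g b by rewrite -autM mulg1.
have [sp _] := gcomp_direct A; have [r [x xA ->]] := sp a.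
rewrite linear_sum; apply: eq_bigr => k _.
by have := xA k; rewrite -(aut_gcomp s 1%g k) => -[b _ <-]; apply: sK.
Qed.

Lemma aut_comp (K : finGroupType) (s : autGroup K) x k a :
  gcomp A k a -> gcomp A k (s x a).
Proof. by move=> Aa; rewrite -(aut_gcomp s x k); exists a. Qed.

Section Restriction.

Variables (K : finGroupType) (s : autGroup K) (L : {group K}).

Lemma restr_abelian : abelian [set: subg_of L]%SET.
Proof.
apply/centsP => u _ v _; apply: val_inj.
by have /centsP := aut_abelian s; apply; rewrite inE.
Qed.

Definition restr_aut : autGroup (subg_of L).
Proof.
refine (@AutGroup _ (fun u => s (sgval u)) restr_abelian _ _ _).
- by move=> u v a; rewrite /= autM.
- by move=> u v uv; apply/val_inj/(aut_inj uv).
- by move=> u k; apply: aut_gcomp.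
Defined.

Lemma restr_dual_neq0 (g : dual C K) (u : subg_of L) : g (sgval u) != 0.
Proof. exact: dual_neq0. Qed.

Lemma restr_dual_mul (g : dual C K) (u v : subg_of L) :
  g (sgval (u * v)%g) = g (sgval u) * g (sgval v).
Proof. by rewrite dualM. Qed.

Definition restr_dual (g : dual C K) : dual C (subg_of L) :=
  mkdual (restr_dual_neq0 g) (restr_dual_mul g).

Lemma restr_dualE (g : dual C K) u : restr_dual g u = g (sgval u).
Proof. exact: mkdualE. Qed.

Lemma restr_dual_is_additive : zmod_morphism restr_dual.
Proof.
move=> f g; apply: dualP => u.
by rewrite restr_dualE !dualDE !dualNE !restr_dualE.
Qed.

HB.instance Definition _ :=
  GRing.isZmodMorphism.Build (dual C K) (dual C (subg_of L)) restr_dual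
    restr_dual_is_additive.

End Restriction.

Section Isotypic.

Variables (K : finGroupType) (s : autGroup K).

Definition isotypic (k : Z) (f : dual C K) : set A :=
  [set a | gcomp A k a /\ forall x, s x a = f x *: a].

Definition isotypic_sum (f : dual C K) : set A := sum_set (isotypic^~ f).

(* the projection of A onto isotypic_sum f along the other isotypic parts *)
Definition isoproj (f : dual C K) (a : A) : A :=
  (#|K|%:R)^-1 *: \sum_x (f x)^-1 *: s x a.

Lemma cardK_neq0 : #|K|%:R != 0 :> C.
Proof. by rewrite pnatr_eq0 -lt0n -cardsT cardG_gt0. Qed.

Lemma isoproj_is_linear f : linear (isoproj f).
Proof.
move=> c a b; rewrite /isoproj scalerA mulrC -scalerA -scalerDr; congr (_ *: _).
rewrite scaler_sumr -big_split; apply: eq_bigr => x _.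
by rewrite linearP scalerDr !scalerA mulrC.
Qed.

HB.instance Definition _ f :=
  GRing.isLinear.Build C A A *:%R (isoproj f) (isoproj_is_linear f).

Lemma isotypic_eig k f a : isotypic k f a -> forall x, s x a = f x *: a.
Proof. by case. Qed.

Lemma isotypic_sum_eig f a : isotypic_sum f a -> forall x, s x a = f x *: a.
Proof.
case=> r [b bA ->] x; rewrite linear_sum scaler_sumr.
by apply: eq_bigr => k _; apply: (isotypic_eig (bA k)).
Qed.

Lemma isoproj_eig f (g : dual C K) a : (forall x, s x a = g x *: a) ->
  isoproj f a = if f == g then a else 0.
Proof.
move=> ag; rewrite /isoproj.
under eq_bigr => x _ do rewrite ag scalerA mulrC -dualNE -dualDE.
rewrite -scaler_suml sum_dual subr_eq0 eq_sym; case: eqP => _.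
  by rewrite scalerA mulVf ?scale1r ?cardK_neq0.
by rewrite scale0r scaler0.
Qed.

Lemma isoproj_act f a x : s x (isoproj f a) = f x *: isoproj f a.
Proof.
rewrite /isoproj linearZ linear_sum scalerA mulrC -scalerA; congr (_ *: _).
rewrite [in RHS](reindex_inj (mulgI x)) scaler_sumr; apply: eq_bigr => y _.
rewrite linearZ /= -autM dualM scalerA invfM mulrA mulfV ?mul1r //.
exact: dual_neq0.
Qed.

Lemma isoproj_comp f k a : gcomp A k a -> isotypic k f (isoproj f a).
Proof.
move=> Aa; split; last exact: isoproj_act.
have [_ _ AZ] := gcomp_subspace A k; apply: (AZ).
apply: (subspace_sum (gcomp_subspace A k)) => x _; apply: AZ.
exact: aut_comp.
Qed.

Lemma eigM (f g : dual C K) x a b : s x a = f x *: a -> s x b = g x *: b ->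
  s x (a * b) = (f + g) x *: (a * b).
Proof. by move=> aE bE; rewrite rmorphM /= aE bE dualDE -scalerAl -scalerAr scalerA. Qed.

Lemma isoproj_in f a : isotypic_sum f (isoproj f a).
Proof.
have [sp _] := gcomp_direct A; have [r [b bA ->]] := sp a.
exists r, (fun k => isoproj f (b k)); last by rewrite linear_sum.
by move=> k; apply/isoproj_comp/bA.
Qed.

Lemma isoproj_sum a : \sum_f isoproj f a = a.
Proof.
rewrite /isoproj -scaler_sumr exchange_big (bigD1 1%g) //= [X in _ + X]big1.
  rewrite addr0 aut1 -scaler_suml; under eq_bigr do rewrite dual1 invr1.
  by rewrite sumr_const (card_dual C (aut_abelian s)) scalerA mulVf ?scale1r ?cardK_neq0.
move=> x x1; rewrite -scaler_suml.
under eq_bigr do rewrite -dualNE.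
rewrite -(reindex_inj (@oppr_inj (dual C K)) (P := xpredT) (F := fun f : dual C K => f x)).
by rewrite (sum_over_dual_neq1 C (aut_abelian s) x1) scale0r.
Qed.

Lemma isoprojM f a b :
  isoproj f (a * b) = \sum_g isoproj g a * isoproj (f - g) b.
Proof.
rewrite -{1}(isoproj_sum a) mulr_suml linear_sum; apply: eq_bigr => g _.
rewrite -{1}(isoproj_sum b) mulr_sumr linear_sum (bigD1 (f - g)) //= big1 ?addr0.
  rewrite (@isoproj_eig _ (g + (f - g))) => [|x]; first by rewrite addrC subrK eqxx.
  by apply: eigM; apply: isoproj_act.
move=> h hfg; rewrite (@isoproj_eig _ (g + h)) => [|x].
  by case: (f =P g + h) hfg => // ->; rewrite addrAC subrr add0r eqxx.
by apply: eigM; apply: isoproj_act.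
Qed.

Lemma isotypic_subspace k f : subspace *:%R (isotypic k f).
Proof.
have [A0 AD AZ] := gcomp_subspace A k; split.
- by split=> // x; rewrite linear0 scaler0.
- move=> a b [Aa aE] [Ab bE]; split; first exact: AD.
  by move=> x; rewrite linearD /= aE bE scalerDr.
- move=> c a [Aa aE]; split; first exact: AZ.
  by move=> x; rewrite linearZ /= aE !scalerA mulrC.
Qed.

Lemma isotypicM j k f g a b : isotypic j f a -> isotypic k g b ->
  isotypic (j + k) (f + g) (a * b).
Proof.
case=> Aa aE [Ab bE]; split; first exact: gcompM.
by move=> x; apply: eigM.
Qed.

Lemma isotypic_direct :
  direct_decomposition (fun kf : Z * dual C K => isotypic kf.1 kf.2).
Proof.
have [sp ind] := gcomp_direct A; split=> [a | r x ur xA x0 [k f] kfr].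
  have [r [b bA ->]] := sp a.
  exists [seq (k, f) | k <- r, f <- enum {: dual C K}],
         (fun kf => isoproj kf.2 (b kf.1)).
    by move=> [k f]; apply/isoproj_comp/bA.
  rewrite big_allpairs; apply: eq_bigr => k _.
  by rewrite big_enum /= isoproj_sum.
have {}x0 : \sum_(kf <- r | kf.2 == f) x kf = 0.
  transitivity (isoproj f (\sum_(kf <- r) x kf)); last by rewrite x0 linear0.
  rewrite big_mkcond linear_sum.
  apply: eq_bigr => kf _; rewrite /= (isoproj_eig f (isotypic_eig (xA kf))).
  by rewrite eq_sym; case: eqP.
apply: (ind [seq kf.1 | kf <- r & kf.2 == f] (fun k => x (k, f))).
- rewrite map_inj_in_uniq ?filter_uniq // => -[k1 f1] [k2 f2].
  by rewrite !mem_filter /= => /andP[/eqP-> _] /andP[/eqP-> _] ->.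
- by move=> i; have [] := xA (i, f).
- rewrite big_map big_filter -[RHS]x0; apply: eq_bigr => -[k1 f1] /= /eqP ->.
  by [].
- by apply/mapP; exists (k, f) => //; rewrite mem_filter eqxx.
Qed.

(* A regarded as a graded algebra with components A^F_{k,f} *)
Definition regrade : gradedAlgebra C (Z * dual C K)%type.
Proof.
refine (@GradedAlgebra C _ A (fun kf : Z * dual C K => isotypic kf.1 kf.2) _ isotypic_direct _).
  by move=> kf; apply: isotypic_subspace.
by move=> [j f] [k g] a b; apply: isotypicM.
Defined.

Variable M : gradedModule A.

Definition covering (W : dual C K -> set M) : Prop :=
  [/\ forall f, subspace (@cscale C A M) (W f) /\ is_graded (W f),
      forall m, sum_set W m
    & forall f f' a m, isotypic_sum f a -> W f' m -> W (f + f') (a *: m)].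

Definition thin (W : dual C K -> set M) : Prop :=
  covering W /\
  forall N, covering N -> (forall f, N f `<=` W f) -> forall f, N f = W f.

Lemma thin_covering W : thin W -> covering W.
Proof. by case. Qed.

End Isotypic.

Section ExternalSum.

Variables (K : finGroupType) (s : autGroup K) (M : gradedModule A).
Variables (W : dual C K -> set M) (covW : covering s W).

Lemma coveringZ f c m : W f m -> W f (cscale c m).
Proof. by case: covW => /(_ f)[[_ _ WZ] _] _ _; apply: WZ. Qed.

Lemma covering0 f : W f 0.
Proof. by case: covW => /(_ f)[[]]. Qed.

Lemma coveringD f m n : W f m -> W f n -> W f (m + n).
Proof. by case: covW => /(_ f)[[_ WD _] _] _ _; apply: WD. Qed.

Lemma coveringN f m : W f m -> W f (- m).
Proof. by move=> /(coveringZ (-1)); rewrite /cscale scaleN1r scaleN1r. Qed.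

Lemma covering_sum f (I : Type) (r : seq I) (P : pred I) (m : I -> M) :
  (forall i, W f (m i)) -> W f (\sum_(i <- r | P i) m i).
Proof. by move=> Wm; apply: big_ind => //; [apply: covering0 | move=> ? ?; apply: coveringD]. Qed.

Definition ext_pred (_ : covering s W) : {pred {ffun dual C K -> M}} :=
  fun m => `[< forall f, W f (m f) >].

Record ext_sum := ExtSum {
  ext_val :> {ffun dual C K -> M};
  ext_valP : ext_val \in ext_pred covW }.

HB.instance Definition _ := [isSub for ext_val].
HB.instance Definition _ := [Choice of ext_sum by <:].

Lemma ext_pred_closed : zmod_closed (ext_pred covW).
Proof.
split=> [|m n /asboolP Wm /asboolP Wn]; apply/asboolP => f; rewrite !ffunE.
  exact: covering0.
by apply: coveringD => //; apply: coveringN.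
Qed.

HB.instance Definition _ :=
  GRing.isZmodClosed.Build {ffun dual C K -> M} (ext_pred covW) ext_pred_closed.
HB.instance Definition _ := [SubChoice_isSubZmodule of ext_sum by <:].

Lemma ext_in (m : ext_sum) f : W f (m f).
Proof. by case: m => m /= /asboolP. Qed.

Lemma ext_eqP (m n : ext_sum) : (forall f, m f = n f) -> m = n.
Proof. by move=> mn; apply/val_inj/ffunP. Qed.

Lemma ext_addE (m n : ext_sum) f : (m + n) f = m f + n f.
Proof. by rewrite ffunE. Qed.

Lemma ext_zeroE f : (0 : ext_sum) f = 0.
Proof. by rewrite ffunE. Qed.

Lemma ext_sumE (I : Type) (r : seq I) (P : pred I) (m : I -> ext_sum) f :
  (\sum_(i <- r | P i) m i) f = \sum_(i <- r | P i) m i f.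
Proof. by elim/big_rec2: _ => [|i x y _ <-]; rewrite ?ext_zeroE ?ext_addE. Qed.

Lemma ext_scale_proof (a : A) (m : ext_sum) :
  [ffun h => \sum_f isoproj s f a *: m (h - f)] \in ext_pred covW.
Proof.
apply/asboolP => h; rewrite ffunE; apply: covering_sum => f.
rewrite -{1}(subrK f h) addrC; case: covW => _ _; apply; first exact: isoproj_in.
exact: ext_in.
Qed.

(* the action extending by linearity the one where a in isotypic_sum f maps the
   g-th summand to the (f + g)-th one by the action on M: see ext_scale_single *)
Definition ext_scale (a : A) (m : ext_sum) : ext_sum := ExtSum (ext_scale_proof a m).

Lemma ext_scaleE a m h : ext_scale a m h = \sum_f isoproj s f a *: m (h - f).
Proof. by rewrite ffunE. Qed.

Lemma ext_scale_eig a m (f : dual C K) h : (forall x, s x a = f x *: a) ->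
  ext_scale a m h = a *: m (h - f).
Proof.
move=> aE; rewrite ext_scaleE (bigD1 f) //= (isoproj_eig f aE) eqxx big1 ?addr0 //.
by move=> g /negPf gf; rewrite (isoproj_eig g aE) gf scale0r.
Qed.

Lemma ext_scaleA a b m : ext_scale a (ext_scale b m) = ext_scale (a * b) m.
Proof.
apply: ext_eqP => h; rewrite !ext_scaleE.
under [RHS]eq_bigr do rewrite isoprojM scaler_suml.
rewrite [RHS]exchange_big; apply: eq_bigr => f _.
rewrite ext_scaleE scaler_sumr [RHS](reindex_inj (addrI f)); apply: eq_bigr => g _.
by rewrite scalerA opprD addrA [f + g]addrC addrK.
Qed.

Lemma ext_scale1 : left_id 1 ext_scale.
Proof.
move=> m; apply: ext_eqP => h; rewrite (@ext_scale_eig _ _ 0) ?subr0 ?scale1r //.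
by move=> x; rewrite rmorph1 dual0E scale1r.
Qed.

Lemma ext_scaleDr : right_distributive ext_scale +%R.
Proof.
move=> a m n; apply: ext_eqP => h; rewrite ext_addE !ext_scaleE -big_split.
by apply: eq_bigr => f _; rewrite ext_addE scalerDr.
Qed.

Lemma ext_scaleDl m : {morph ext_scale^~ m : a b / a + b}.
Proof.
move=> a b; apply: ext_eqP => h; rewrite ext_addE !ext_scaleE -big_split.
by apply: eq_bigr => f _; rewrite linearD scalerDl.
Qed.

HB.instance Definition _ :=
  GRing.Zmodule_isLmodule.Build A ext_sum ext_scaleA ext_scale1 ext_scaleDr ext_scaleDl.

Lemma ext_cscaleE c (m : ext_sum) h : (cscale c m) h = cscale c (m h).
Proof.
have cE x : s x c%:A = (0 : dual C K) x *: c%:A.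
  by rewrite linearZ rmorph1 dual0E scale1r.
by have := ext_scale_eig m h cE; rewrite subr0.
Qed.

Lemma ext_single_proof f m : W f m ->
  [ffun h => if h == f then m else 0] \in ext_pred covW.
Proof.
by move=> Wm; apply/asboolP => h; rewrite ffunE; case: eqP => [->|_] //; apply: covering0.
Qed.

Definition ext_single f m (Wm : W f m) : ext_sum := ExtSum (ext_single_proof Wm).

Lemma ext_singleE f m (Wm : W f m) h : ext_single Wm h = if h == f then m else 0.
Proof. by rewrite ffunE. Qed.

Lemma covering_act f g a m : isotypic_sum s f a -> W g m -> W (f + g) (a *: m).
Proof. by case: covW => _ _; apply. Qed.

Lemma ext_scale_single f g a m (Aa : isotypic_sum s f a) (Wm : W g m) :
  a *: ext_single Wm = ext_single (covering_act Aa Wm).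
Proof.
apply: ext_eqP => h.
have -> : (a *: ext_single Wm) h = a *: ext_single Wm (h - f).
  exact/ext_scale_eig/isotypic_sum_eig.
by rewrite !ext_singleE subr_eq [g + f]addrC; case: eqP; rewrite ?scaler0.
Qed.

Definition ext_comp (nf : Z * dual C K) : set ext_sum :=
  [set m | mcomp M nf.1 (m nf.2) /\ forall h, h != nf.2 -> m h = 0].

Lemma ext_comp_subspace nf : subspace (@cscale C A ext_sum) (ext_comp nf).
Proof.
have [M0 MD MZ] := mcomp_subspace M nf.1; split.
- by split=> [|h _]; rewrite ext_zeroE.
- move=> m n [Mm m0] [Mn n0]; split=> [|h hf]; rewrite ext_addE; first exact: MD.
  by rewrite m0 // n0 // addr0.
- move=> c m [Mm m0]; split=> [|h hf]; rewrite ext_cscaleE; first exact: MZ.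
  by rewrite m0 // /cscale scaler0.
Qed.

Lemma ext_comp_direct : direct_decomposition ext_comp.
Proof.
have [_ ind] := mcomp_direct M; split=> [m | r x ur xM x0 [n f] nfr].
  have /choice[rx rxP] : forall f, exists rx : seq Z * (Z -> M),
      (forall n, W f (rx.2 n) /\ mcomp M n (rx.2 n)) /\
      m f = \sum_(n <- rx.1) rx.2 n.
    move=> f; have [/(_ f)[_ grW] _ _] := covW.
    by have [r [x xP ->]] := grW _ (ext_in m f); exists (r, x).
  exists [seq (n, f) | f <- enum {: dual C K}, n <- (rx f).1],
         (fun nf => ext_single ((rxP nf.2).1 nf.1).1).
    move=> [n f]; split=> [|h hf]; rewrite ext_singleE ?eqxx /= ?(negPf hf) //.
    by have [] := (rxP f).1 n.
  rewrite big_allpairs_dep big_enum /=; apply: ext_eqP => h.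
  rewrite ext_sumE (bigD1 h) //= [X in _ + X]big1 ?addr0 => [|f fh].
    rewrite ext_sumE; apply: etrans (rxP h).2 _.
    by apply: eq_bigr => n _; rewrite ext_singleE eqxx.
  by rewrite ext_sumE big1 // => n _; rewrite ext_singleE eq_sym (negPf fh).
apply: ext_eqP => h; rewrite ext_zeroE; have [_ xnf0] := xM (n, f).
have [->|/xnf0//] := eqVneq h f.
apply: (ind [seq nf.1 | nf <- r & nf.2 == f] (fun n => x (n, f) f)).
- rewrite map_inj_in_uniq ?filter_uniq // => -[n1 f1] [n2 f2].
  by rewrite !mem_filter /= => /andP[/eqP-> _] /andP[/eqP-> _] ->.
- by move=> i; have [] := xM (i, f).
- transitivity ((\sum_(nf <- r) x nf) f); last by rewrite x0 ext_zeroE.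
  rewrite ext_sumE [RHS](bigID (fun nf => nf.2 == f)) /=.
  rewrite [X in _ = _ + X]big1 ?addr0 => [|[n1 f1] /= f1f].
    by rewrite big_map big_filter; apply: eq_bigr => -[n1 f1] /= /eqP ->.
  by have [_ /(_ f)] := xM (n1, f1); apply; rewrite eq_sym.
- by apply/mapP; exists (n, f) => //; rewrite mem_filter eqxx.
Qed.

Lemma ext_compZ (kg nf : Z * dual C K) (a : A) (m : ext_sum) :
  isotypic s kg.1 kg.2 a -> ext_comp nf m -> ext_comp (kg + nf) (a *: m).
Proof.
case: kg nf => k g [n f] [/= Aa aE] [/= Mm m0].
have amE h : (a *: m) h = a *: m (h - g) by apply: ext_scale_eig.
split=> [|h]; rewrite amE /=; first by rewrite [g + f]addrC addrK; apply: mcompZ.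
by rewrite -subr_eq0 opprD addrA subr_eq0 => /m0 ->; rewrite scaler0.
Qed.

(* the (Z x F)-graded A-module given by the external direct sum of a covering *)
Definition ext_module : gradedModule (regrade s) :=
  @GradedModule C _ (regrade s) ext_sum ext_comp
    ext_comp_subspace ext_comp_direct ext_compZ.

End ExternalSum.

Section Inertia.

Variables (K : finGroupType) (s : autGroup K) (M : gradedModule A).

(* the automorphisms sigma such that M and M^sigma are isomorphic *)
Definition inertia : {set K} :=
  [set x | `[< graded_iso M (twisted_module (aut_gcomp s x) M) >]]%SET.

Lemma inertia_group_set : group_set inertia.
Proof.
apply/group_setP; split=> [|x y].
  rewrite inE; apply/asboolP.
  have id_lin : linear (id : M -> twist (s 1%g) M).
    by move=> a m n; rewrite twist_scaleE aut1.
  pose phi : {linear M -> twist (s 1%g) M} :=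
    HB.pack (id : M -> twist (s 1%g) M) (GRing.isLinear.Build A M _ _ _ id_lin).
  exists phi; first by exists id.
  by move=> n; rewrite image_id.
rewrite !inE => -[phi [phi' phiK phiK'] phiM] [psi [psi' psiK psiK'] psiM].
pose th : M -> twist (s (x * y)%g) M := fun m => phi (psi m).
have th_lin : linear th.
  by move=> a m n; rewrite /th !linearP !twist_scaleE autM.
pose theta : {linear M -> twist (s (x * y)%g) M} :=
  HB.pack th (GRing.isLinear.Build A M _ _ _ th_lin).
exists theta; last by move=> n; rewrite -(image_comp psi phi) psiM phiM.
by exists (fun m : M => psi' (phi' m)) => m; rewrite /= /th ?phiK ?psiK // psiK' phiK'.
Qed.

Canonical inertia_group := Group inertia_group_set.

End Inertia.

(* for a of degree k - n this is rho_nk(a), with the codomain M_k enlarged to M *)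
Definition rho (M : gradedModule A) (n : Z) (a : A) : mcomp M n -> M :=
  fun m => a *: set_val m.

End Coverings.

Arguments restr_dual {C K} L g.
Arguments rho {C Z A} M n a.

(* Main.v *)
Require Import Defs.
From HB Require Import structures.
From mathcomp Require Import all_boot all_order all_fingroup all_algebra.
From mathcomp Require Import complex.
From mathcomp Require Import boolp classical_sets functions reals.

Set Implicit Arguments.
Unset Strict Implicit.
Unset Printing Implicit Defensive.

Import Order.TTheory GRing.Theory Num.Theory.

Local Open Scope classical_set_scope.
Local Open Scope ring_scope.

(** Twisting [M] by the elements [x] of the group of automorphisms gives graded-simple modules
    [M^x], and [M^x] is isomorphic to [M] exactly when [x] lies in the inertia group.  The
    comparison of the two kinds of coverings rests on one consequence of this
    ([isotypic_unit]): if a character [f] is trivial on the inertia group then, for every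
    degree [n], some element of degree 0 and character [f] acts as the identity on [M_n].
    To find it, take [b] of degree 0 acting as 1 on [M_n] and as 0 on the degree [n] part of
    [M^x] for every [x] outside the inertia group.  Such a [b] comes from a density argument
    ([separate], [separating_unit]), where quasifiniteness over an algebraically closed field
    enters through Schur's lemma: graded endomorphisms of [M] are scalars.  The translates of
    [b] under the group then act on [M_n] as 1 or 0, according to whether the group element is
    in the inertia group or not, so that the average of [b] against [f] acts on [M_n] as a
    nonzero scalar.

    Multiplication by such units moves an algebra element from one character to another with
    the same restriction to the inertia group, without changing the way it acts on [M_n].
    So isotypic components for the two groups have the same image under [rho]
    ([rho_isotypic]).  Moreover every covering indexed by the dual of the whole group is
    constant on the fibres of restriction ([covering_constant]), so that the coverings for the
    two groups are the same families up to reindexing; the reindexing preserves inclusions,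
    hence thinness ([thin_bijection]).

    Let [P] be the external sum of a thin covering.  The components of the elements of a nonzero
    graded submodule of [P] form a covering inside the given one, and thinness says that
    nothing was lost, so [P] is graded-simple ([ext_module_simple]).  To compare [P] with
    another such sum [P'], consider for each [x] the evaluation [eval_dual x], which is a
    [Z]-graded homomorphism from [P'] to [M^x].  By orthogonality of characters the
    evaluations are jointly injective.  Take a maximal set of evaluations whose common kernel
    [X] is nonzero: any further evaluation, at [x0] say, is injective on [X], so that [X] is a
    copy of [M^x0] in [P'].  The composite of [P -> M^x0] with this
    embedding is nonzero but only [Z]-graded; since the dual group is finite, it is the sum of
    its parts that are homogeneous for the dual, and a nonzero part is an isomorphism up to a
    shift by Schur's lemma ([ext_module_iso]). *)

(** * Projections attached to a direct decomposition *)

(** Subspaces of the algebra, subspaces of modules and submodules are closed under different scalar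
    multiplications; what they share, and what projections rely on, is the additive structure. *)
Definition subgroup (V : zmodType) (S : set V) : Prop :=
  S 0 /\ forall x y, S x -> S y -> S (x - y).

Section Subgroup.
Variables (V : zmodType) (S : set V).
Hypothesis sS : subgroup S.

Lemma subgroup0 : S 0. Proof. by case: sS. Qed.
Lemma subgroupB x y : S x -> S y -> S (x - y). Proof. by case: sS => _; apply. Qed.
Lemma subgroupN x : S x -> S (- x).
Proof. by move=> Sx; rewrite -sub0r; apply: subgroupB => //; apply: subgroup0. Qed.
Lemma subgroupD x y : S x -> S y -> S (x + y).
Proof. by move=> Sx Sy; rewrite -[y]opprK; apply/subgroupB/subgroupN. Qed.
Lemma subgroupMn x n : S x -> S (x *+ n).
Proof.
by move=> Sx; elim: n => [|n IH]; rewrite ?mulr0n ?mulrS; [apply: subgroup0 | apply: subgroupD].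
Qed.
Lemma subgroup_sum (I : eqType) (r : seq I) (P : pred I) (x : I -> V) :
  (forall i, i \in r -> P i -> S (x i)) -> S (\sum_(i <- r | P i) x i).
Proof.
move=> Sx; rewrite big_seq_cond; apply: big_ind => [|y z|i /andP[ir Pi]].
- exact: subgroup0.
- exact: subgroupD.
- exact: Sx.
Qed.
End Subgroup.

Section Projections.

Variables (I : choiceType) (V : zmodType) (W : I -> set V).

Lemma extend_support (s t : seq I) (x : I -> V) : uniq s -> uniq t ->
  {subset s <= t} -> (forall i, i \notin s -> x i = 0) ->
  \sum_(i <- s) x i = \sum_(i <- t) x i.
Proof.
move=> us ut st x0; rewrite [RHS](bigID (mem s)) /= [X in _ + X]big1 => [|i /x0 //].
rewrite addr0 -[RHS]big_filter; apply: perm_big; apply: uniq_perm => //.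
  by rewrite filter_uniq.
by move=> i; rewrite mem_filter /=; case: (boolP (i \in s)) => // /st ->.
Qed.

Hypothesis subW : forall i, subgroup (W i).

(** A family listed with repetitions can be listed without them: the multiplicities are
    absorbed by the entries. *)
Lemma sum_set_uniq v : sum_set W v -> exists s : seq I, exists x : I -> V,
  [/\ uniq s, forall i, W i (x i), forall i, i \notin s -> x i = 0
    & v = \sum_(i <- s) x i].
Proof.
case=> s [x xW ->]; exists (undup s), (fun i => x i *+ count_mem i s); split.
- exact: undup_uniq.
- by move=> i; apply: subgroupMn.
- move=> i; rewrite mem_undup => /count_memPn ->; exact: mulr0n.
- by rewrite big_undup_iterop_count; apply: eq_bigr => i _.
Qed.

Lemma sum_setI (i : I) v : W i v -> sum_set W v.
Proof.
move=> Wv; exists [:: i], (fun j => if j == i then v else 0).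
  by move=> j; case: eqP => [->|_] //; apply: subgroup0.
by rewrite big_seq1 eqxx.
Qed.

Lemma sum_set_subgroup : subgroup (sum_set W).
Proof.
split=> [|v w].
  by exists [::], (fun=> 0); [move=> i; apply: subgroup0 | rewrite big_nil].
move=> /sum_set_uniq[s [x [us xW x0 ->]]] /sum_set_uniq[t [y [ut yW y0 ->]]].
exists (undup (s ++ t)), (fun i => x i - y i).
  by move=> i; apply: subgroupB.
rewrite big_split sumrN /=; congr (_ - _).
- apply: extend_support => // [|i]; first exact: undup_uniq.
  by rewrite mem_undup mem_cat => ->.
- apply: extend_support => // [|i]; first exact: undup_uniq.
  by rewrite mem_undup mem_cat orbC => ->.
Qed.

Hypothesis dirW : direct_decomposition W.

Lemma decomposition_eq0 (s : seq I) (x : I -> V) :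
  uniq s -> (forall i, W i (x i)) -> (forall i, i \notin s -> x i = 0) ->
  \sum_(i <- s) x i = 0 -> forall i, x i = 0.
Proof.
move=> us xW x0 sx i; have [i_s|/x0 //] := boolP (i \in s).
by case: dirW => _ /(_ s x us xW sx i i_s).
Qed.

Lemma decomposition_exists v : exists x : I -> V, 
  (forall i, W i (x i)) /\ exists s : seq I, [/\ uniq s, 
    forall i, i \notin s -> x i = 0 & v = \sum_(i <- s) x i].
Proof.
case: dirW => sp _; have /sum_set_uniq[s [x [us xW x0 ->]]] := sp v.
by exists x; split=> //; exists s.
Qed.

Definition proj (i : I) (v : V) : V := sval (cid (decomposition_exists v)) i.

Lemma proj_in i v : W i (proj i v).
Proof. by rewrite /proj; case: cid => x /= []. Qed.

Lemma proj_sum v : exists s : seq I, [/\ uniq s,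
  forall i, i \notin s -> proj i v = 0 & v = \sum_(i <- s) proj i v].
Proof. by rewrite /proj; case: cid => x /= []. Qed.

Lemma projB i v w : proj i (v - w) = proj i v - proj i w.
Proof.
have [s [us s0 sv]] := proj_sum v; have [t [ut t0 tw]] := proj_sum w.
have [r [ur r0 rvw]] := proj_sum (v - w).
pose q := undup (r ++ s ++ t).
have uq : uniq q by apply: undup_uniq.
have rq : {subset r <= q} by move=> j jr; rewrite mem_undup mem_cat jr.
have sq : {subset s <= q} by move=> j js; rewrite mem_undup !mem_cat js orbT.
have tq : {subset t <= q} by move=> j jt; rewrite mem_undup !mem_cat jt !orbT.
apply/eqP; rewrite -subr_eq0; apply/eqP.
apply: (decomposition_eq0 (s := q) (x := fun i => proj i (v - w) - (proj i v - proj i w))) => //.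
- by move=> j; apply: subgroupB (proj_in _ _) _ => //; apply: subgroupB (proj_in _ _) (proj_in _ _).
- move=> j; rewrite mem_undup !mem_cat !negb_or => /and3P[jr js jt].
  by rewrite r0 // s0 // t0 // !subr0.
- rewrite !sumrB -(extend_support ur uq rq r0) -(extend_support us uq sq s0).
  by rewrite -(extend_support ut uq tq t0) -rvw -sv -tw subrr.
Qed.

Lemma proj0 i : proj i 0 = 0.
Proof. by have := projB i 0 0; rewrite !subrr. Qed.

Lemma projN i v : proj i (- v) = - proj i v.
Proof. by rewrite -sub0r projB proj0 sub0r. Qed.

Lemma projD i v w : proj i (v + w) = proj i v + proj i w.
Proof. by rewrite -{1}[w]opprK projB projN opprK. Qed.

Lemma proj_big i (J : Type) (r : seq J) (P : pred J) (v : J -> V) :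
  proj i (\sum_(j <- r | P j) v j) = \sum_(j <- r | P j) proj i (v j).
Proof. by elim/big_rec2: _ => [|j x y _ <-]; rewrite ?proj0 ?projD. Qed.

Lemma proj_id i j v : W j v -> proj i v = if i == j then v else 0.
Proof.
move=> Wv; have [s [us s0 sv]] := proj_sum v.
pose t := undup (j :: s); have ut : uniq t by apply: undup_uniq.
have st : {subset s <= t} by move=> k ks; rewrite mem_undup inE ks orbT.
apply/eqP; rewrite -subr_eq0; apply/eqP.
apply: (decomposition_eq0 (s := t) (x := fun i => proj i v - if i == j then v else 0)) => //.
- move=> k; apply: subgroupB => //; first exact: proj_in.
  by case: eqP => [->|_] //; apply: subgroup0.
- move=> k; rewrite mem_undup inE negb_or => /andP[/negPf-> ks].
  by rewrite s0 // subr0.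
- rewrite sumrB -(extend_support us ut st s0) -sv (bigD1_seq j) //=; last first.
    by rewrite mem_undup mem_head.
  by rewrite eqxx big1 ?addr0 ?subrr // => k /negPf->.
Qed.

Lemma proj_eq v w : (forall i, proj i v = proj i w) -> v = w.
Proof.
move=> vw; apply/eqP; rewrite -subr_eq0; apply/eqP.
have [s [us _ ->]] := proj_sum (v - w).
by apply: big1 => i _; rewrite projB vw subrr.
Qed.

Lemma sum_set_proj (N : set V) i v : subgroup N ->
  sum_set (fun i => N `&` W i) v -> N (proj i v).
Proof.
move=> sN [s [x xN ->]]; rewrite proj_big; apply: subgroup_sum => // j _ _.
have [Nx Wx] := xN j; rewrite (proj_id _ Wx).
by case: eqP => // _; apply: subgroup0.
Qed.

Lemma proj_sum_set (N : set V) v :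
  (forall i, N (proj i v)) -> sum_set (fun i => N `&` W i) v.
Proof.
move=> Nv; have [s [_ _ sv]] := proj_sum v; exists s, (fun i => proj i v) => //.
by move=> i; split=> //; apply: proj_in.
Qed.

End Projections.

(** * Graded modules and Schur's lemma *)

Section GradedTools.

Variables (C : numClosedFieldType) (Z : zmodType) (A : gradedAlgebra C Z).

Lemma gcomp_subgroup k : subgroup (gcomp A k).
Proof.
have [A0 AD AZ] := gcomp_subspace A k; split=> // a b Aa Ab.
by apply: AD => //; rewrite -scaleN1r; apply: AZ.
Qed.

Definition algpart (k : Z) : A -> A := proj gcomp_subgroup (gcomp_direct A) k.

Section OneModule.

Variable M : gradedModule A.

Lemma cscaleDr c (m n : M) : cscale c (m + n) = cscale c m + cscale c n.
Proof. exact: scalerDr. Qed.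

Lemma cscaler0 c : cscale c (0 : M) = 0.
Proof. exact: scaler0. Qed.

Lemma cscale0r (m : M) : cscale (0 : C) m = 0.
Proof. by rewrite /cscale scale0r scale0r. Qed.

Lemma cscale1r (m : M) : cscale (1 : C) m = m.
Proof. by rewrite /cscale scale1r scale1r. Qed.

Lemma cscaleDl c d (m : M) : cscale (c + d) m = cscale c m + cscale d m.
Proof. by rewrite /cscale scalerDl scalerDl. Qed.

Lemma cscaleN1 (m : M) : cscale (-1 : C) m = - m.
Proof. by rewrite /cscale scaleN1r scaleN1r. Qed.

Lemma cscaleA c d (m : M) : cscale c (cscale d m) = cscale (c * d) m.
Proof. by rewrite /cscale scalerA -scalerAl mul1r scalerA. Qed.

Lemma scale_cscale (a : A) c (m : M) : a *: cscale c m = cscale c (a *: m).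
Proof. by rewrite /cscale !scalerA -scalerAr mulr1 -scalerAl mul1r. Qed.

Lemma cscaleAl (a : A) c (m : M) : (c *: a) *: m = cscale c (a *: m).
Proof. by rewrite /cscale scalerA -scalerAl mul1r. Qed.

Lemma cscale_sumr c (I : Type) (r : seq I) (P : pred I) (m : I -> M) :
  cscale c (\sum_(i <- r | P i) m i) = \sum_(i <- r | P i) cscale c (m i).
Proof. exact: scaler_sumr. Qed.

Lemma cscale_suml (I : Type) (r : seq I) (P : pred I) (c : I -> C) (m : M) :
  cscale (\sum_(i <- r | P i) c i) m = \sum_(i <- r | P i) cscale (c i) m.
Proof. by rewrite /cscale scaler_suml scaler_suml. Qed.

Lemma subspace_subgroup (S : set M) : subspace (@cscale C A M) S -> subgroup S.
Proof.
by case=> S0 SD SZ; split=> // x y Sx Sy; apply: SD => //; rewrite -cscaleN1; apply: SZ.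
Qed.

Lemma mcomp_subgroup n : subgroup (mcomp M n).
Proof. exact/subspace_subgroup/mcomp_subspace. Qed.

Definition modpart (n : Z) : M -> M := proj mcomp_subgroup (mcomp_direct M) n.

Lemma modpart_in n m : mcomp M n (modpart n m).
Proof. exact: proj_in. Qed.

Lemma modpart_id k n m : mcomp M n m -> modpart k m = if k == n then m else 0.
Proof. exact: proj_id. Qed.

Lemma modpart_sum n (I : Type) (r : seq I) (P : pred I) (m : I -> M) :
  modpart n (\sum_(i <- r | P i) m i) = \sum_(i <- r | P i) modpart n (m i).
Proof. exact: proj_big. Qed.

Lemma modpart_eq0 m : (forall n, modpart n m = 0) -> m = 0.
Proof.
by move=> m0; apply: (proj_eq (subW := mcomp_subgroup) (dirW := mcomp_direct M)) => n;
  rewrite proj0; apply: m0.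
Qed.

(** On a homogeneous vector, the component of [a m] in degree [k + n] only sees the degree [k] part
    of [a].  All gradedness properties of annihilators come from this. *)
Lemma modpart_scale k n a m : mcomp M n m -> modpart (k + n) (a *: m) = algpart k a *: m.
Proof.
move=> Mm; have [s [us s0 sa]] := proj_sum gcomp_subgroup (gcomp_direct A) a.
rewrite {1}sa scaler_suml modpart_sum.
transitivity (\sum_(i <- s) if i == k then algpart k a *: m else 0).
  apply: eq_bigr => j _; rewrite (modpart_id _ (mcompZ (proj_in _ _ _ _) Mm)).
  by rewrite (inj_eq (addIr n)) eq_sym; case: eqP => // ->.
have [ks|ks] := boolP (k \in s).
  by rewrite (bigD1_seq k) //= eqxx big1 ?addr0 // => i /negPf->.
rewrite /algpart (s0 k ks) scale0r big_seq big1 // => i i_s.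
by case: eqP => // ik; rewrite -ik i_s in ks.
Qed.

Lemma is_graded_modpart (N : set M) n m :
  subgroup N -> is_graded N -> N m -> N (modpart n m).
Proof. by move=> sN gN /gN; apply: sum_set_proj. Qed.

Lemma modpart_is_graded (N : set M) :
  (forall n m, N m -> N (modpart n m)) -> is_graded N.
Proof.
move=> gN m Nm.
by apply: (proj_sum_set (subW := mcomp_subgroup) (dirW := mcomp_direct M)) => n; apply: gN.
Qed.

Lemma graded_simpleP (N : set M) : graded_simple M ->
  N 0 -> (forall x y, N x -> N y -> N (x + y)) -> (forall (a : A) x, N x -> N (a *: x)) ->
  (forall n x, N x -> N (modpart n x)) -> (forall x, N x -> x = 0) \/ (forall x, N x).
Proof.
move=> simM N0 ND NZ /modpart_is_graded gN.
by have [->|->] := simM N (And3 N0 ND NZ) gN; [left | right].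
Qed.

End OneModule.

Lemma modpart_morph (M N : gradedModule A) (f : M -> N) :
  {morph f : x y / x + y} -> (forall n m, mcomp M n m -> mcomp N n (f m)) ->
  forall n m, modpart n (f m) = f (modpart n m).
Proof.
move=> fD fM n m; have f0 : f 0 = 0 by apply: (addrI (f 0)); rewrite -fD !addr0.
have [s [us s0 sm]] := proj_sum (mcomp_subgroup M) (mcomp_direct M) m.
rewrite {1}sm (big_morph f fD f0) modpart_sum.
transitivity (\sum_(i <- s) if i == n then f (modpart n m) else 0).
  apply: eq_bigr => j _; rewrite (modpart_id _ (fM _ _ (proj_in _ _ _ _))).
  by rewrite eq_sym; case: eqP => // ->.
have [ns|ns] := boolP (n \in s).
  by rewrite (bigD1_seq n) //= eqxx big1 ?addr0 // => i /negPf->.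
by rewrite /modpart (s0 n ns) f0 big1 // => i _; exact: if_same.
Qed.

Section Goursat.

Variables (M N : gradedModule A) (simM : graded_simple M) (simN : graded_simple N).

(** Goursat's lemma: by simplicity, a graded submodule [T] of [M * N], seen as a relation, projects
    onto both factors.  As [T] meets [M] trivially, it also meets [N] trivially, for otherwise it
    would contain all of [N], hence some [(x, 0)] with [x] nonzero.  So [T] is the graph of an
    isomorphism. *)
Lemma graph_iso (T : M -> N -> Prop) :
  (forall x y x' y', T x y -> T x' y' -> T (x + x') (y + y')) ->
  (forall (a : A) x y, T x y -> T (a *: x) (a *: y)) ->
  (forall n x y, T x y -> T (modpart n x) (modpart n y)) ->
  (exists x y, x <> 0 /\ T x y) ->
  (forall x, T x 0 -> x = 0) ->
  exists phi : {linear M -> N}, [/\ bijective phi,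
    forall n, phi @` mcomp M n = mcomp N n & forall x y, T x y -> y = phi x].
Proof.
move=> TD TZ Tp [x0 [y0 [x0n0 Tx0]]] Tx.
have T0 : T 0 0 by have := TZ 0 _ _ Tx0; rewrite !scale0r.
have TN x y : T x y -> T (- x) (- y) by move/(TZ (-1)); rewrite !scaleN1r.
have p0 (P : gradedModule A) n : modpart n (0 : P) = 0 by apply: proj0.
have tot x : exists y, T x y.
  have [||| |H|H] := @graded_simpleP M [set x | exists y, T x y] simM.
  - by exists 0.
  - by move=> u v [y Tu] [y' Tv]; exists (y + y'); apply: TD.
  - by move=> a u [y Tu]; exists (a *: y); apply: TZ.
  - by move=> n u [y Tu]; exists (modpart n y); apply: Tp.
  - by case: x0n0; apply: H; exists y0.
  - exact: H.
have onto y : exists x, T x y.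
  have [||| |H|H] := @graded_simpleP N [set y | exists x, T x y] simN.
  - by exists 0.
  - by move=> u v [x Tu] [x' Tv]; exists (x + x'); apply: TD.
  - by move=> a u [x Tu]; exists (a *: x); apply: TZ.
  - by move=> n u [x Tu]; exists (modpart n x); apply: Tp.
  - by case: x0n0; apply: Tx; rewrite -(H y0) //; exists x0.
  - exact: H.
have fst0 y : T 0 y -> y = 0.
  have [||| |H|H _] := @graded_simpleP N [set y | T 0 y] simN; last 2 first.
  - exact: H.
  - case: x0n0; apply: Tx; have := TD _ _ _ _ Tx0 (TN _ _ (H y0)).
    by rewrite oppr0 addr0 subrr.
  - by [].
  - by move=> u v Tu Tv; rewrite -[0]addr0; apply: TD.
  - by move=> a u Tu; rewrite -(scaler0 _ a); apply: TZ.
  - by move=> n u Tu; rewrite -(p0 M n); apply: Tp.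
have uniq_r x y y' : T x y -> T x y' -> y = y'.
  move=> Ty Ty'; apply/eqP; rewrite -subr_eq0; apply/eqP/fst0.
  by rewrite -(subrr x); apply: TD => //; apply: TN.
have uniq_l x x' y : T x y -> T x' y -> x = x'.
  move=> Ty Ty'; apply/eqP; rewrite -subr_eq0; apply/eqP/Tx.
  by rewrite -(subrr y); apply: TD => //; apply: TN.
have [f fT] := choice tot; have [g gT] := choice onto.
have flin : linear f.
  move=> a x y; apply: uniq_r (fT _) _; apply: TD => //; exact: TZ.
pose phi : {linear M -> N} := HB.pack f (GRing.isLinear.Build A M N _ f flin).
have phiE : phi =1 f by [].
exists phi; split=> [|n|x y Txy].
- exists g => x; first exact: uniq_l (gT _) (fT _).
  exact: uniq_r (fT _) (gT _).
- apply/seteqP; split=> [_ [x Mx <-]|y Ny].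
    have := Tp n _ _ (fT x); rewrite (modpart_id _ Mx) eqxx => Tx'.
    rewrite phiE (uniq_r _ _ _ (fT x) Tx'); exact: modpart_in.
  have := Tp n _ _ (gT y); rewrite (modpart_id _ Ny) eqxx => Ty'.
  exists (modpart n (g y)); first exact: modpart_in.
  exact: uniq_r (fT _) Ty'.
- exact: uniq_r Txy (fT _).
Qed.

Lemma schur_iso (phi : {linear M -> N}) :
  (forall n m, mcomp M n m -> mcomp N n (phi m)) -> (exists m, phi m <> 0) ->
  graded_iso M N.
Proof.
move=> phiM [m0 phim0].
have phip := modpart_morph (linearD phi) phiM.
have ker0 x : phi x = 0 -> x = 0.
  have [||| |H|H _] := @graded_simpleP M [set x | phi x = 0] simM; last 2 first.
  - exact: H.
  - by case: phim0; apply: H.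
  - exact: linear0.
  - by move=> u v /= u0 v0; rewrite linearD /= u0 v0 addr0.
  - by move=> a u /= u0; rewrite linearZ /= u0 scaler0.
  - by move=> n u /= u0; rewrite -phip u0; apply: proj0.
have [|||||theta [bij comp _]] := @graph_iso (fun x y => y = phi x).
- by move=> x y x' y' -> ->; rewrite linearD.
- by move=> a x y ->; rewrite linearZ.
- by move=> n x y ->; rewrite phip.
- by exists m0, (phi m0); split=> // m00; apply: phim0; rewrite m00 linear0.
- by move=> x /esym/ker0.
- by exists theta.
Qed.

End Goursat.

End GradedTools.

(** * Graded endomorphisms are scalars *)

Section Eigenvector.

Variables (C : numClosedFieldType) (Z : zmodType) (A : gradedAlgebra C Z).
Variable M : gradedModule A.

(** The characteristic polynomial splits, so the Cayley-Hamilton theorem turns into a product of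
    factors [B - z] that vanishes.  The product is spelled as successive applications to a row
    vector because [endo_eigenvector] looks for the first step at which the image vanishes. *)
Lemma split_annihilator d (B : 'M[C]_d) :
  exists rs : seq C, forall r : 'rV[C]_d,
    foldl (fun (r : 'rV_d) z => r *m B - z *: r) r rs = 0.
Proof.
case: d B => [|d] B; first by exists [::] => r; rewrite [foldl _ _ _]thinmx0.
have [rs Drs] := closed_field_poly_normal (char_poly B).
have {}Drs : char_poly B = \prod_(z <- rs) ('X - z%:P).
  by rewrite {1}Drs (monicP (char_poly_monic B)) scale1r.
have E r : foldl (fun (r : 'rV_d.+1) z => r *m B - z *: r) r rs =
    r *m \prod_(z <- rs) (B - z%:M).
  elim: rs r {Drs} => [|z rs IH] r /=; first by rewrite big_nil mulmx1.
  by rewrite IH big_cons -[_ * _]/(_ *m _) mulmxA mulmxBr mul_mx_scalar.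
exists rs => r; rewrite E.
suff -> : \prod_(z <- rs) (B - z%:M) = 0 by rewrite mulmx0.
rewrite -[RHS](Cayley_Hamilton B) Drs rmorph_prod; apply: eq_bigr => z _.
by rewrite rmorphB /= horner_mx_X horner_mx_C.
Qed.

(** The finite spanning family of [M_n] need not be a basis: [phi] is lifted to a matrix acting on
    coefficient vectors, which is enough since the eigenvector is sought among the images under
    [ev] of the successive vectors given by [split_annihilator]. *)
Lemma endo_eigenvector n (phi : {linear M -> M}) :
  quasifinite M -> (forall m, mcomp M n m -> mcomp M n (phi m)) ->
  (exists m, mcomp M n m /\ m <> 0) ->
  exists z m, [/\ mcomp M n m, m <> 0 & phi m = cscale z m].
Proof.
move=> qfM phiM [m0 [Mm0 m0n0]]; have [d [e eM]] := qfM n.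
pose ev (r : 'rV[C]_d) : M := \sum_i cscale (r 0 i) (e i).
have evM r : mcomp M n (ev r) by rewrite eM; exists (fun i => r 0 i).
have Mev m : mcomp M n m -> exists r, m = ev r.
  rewrite eM => -[c ->]; exists (\row_i c i).
  by apply: eq_bigr => i _; rewrite mxE.
have Me i : mcomp M n (e i).
  rewrite eM; exists (fun j => (j == i)%:R).
  rewrite (bigD1 i) //= eqxx big1 ?addr0 ?cscale1r // => j /negPf ->.
  exact: cscale0r.
have /choice[b bE] : forall i, exists r, phi (e i) = ev r by move=> i; apply/Mev/phiM.
pose B : 'M[C]_d := \matrix_(i, j) b i 0 j.
have phiC c m : phi (cscale c m) = cscale c (phi m) by rewrite linearZ.
have evB r : ev (r *m B) = phi (ev r).
  rewrite linear_sum; under [RHS]eq_bigr do rewrite /= phiC bE cscale_sumr.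
  rewrite exchange_big; apply: eq_bigr => j _; rewrite mxE cscale_suml.
  by apply: eq_bigr => i _; rewrite mxE cscaleA.
have evD r z r' : ev (r - z *: r') = ev r - cscale z (ev r').
  rewrite /ev cscale_sumr -sumrB; apply: eq_bigr => i _.
  by rewrite !mxE cscaleDl -mulN1r -cscaleA cscaleN1 -cscaleA.
have [rs rsB] := split_annihilator B; have [r0 m0E] := Mev _ Mm0.
move: m0n0 (rsB r0); rewrite {}m0E; elim: rs r0 {rsB} => [|z rs IH] r rn0 /=.
  by move=> r_eq0; case: rn0; rewrite r_eq0; apply: big1 => i _; rewrite mxE cscale0r.
have [E|ne] := pselect (ev (r *m B - z *: r) = 0); last exact: IH.
move=> _; exists z, (ev r); split=> //.
by move/eqP: E; rewrite evD evB subr_eq0 => /eqP.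
Qed.

Hypotheses (simM : graded_simple M) (qfM : quasifinite M).

Lemma exists_homogeneous (m : M) : m <> 0 -> exists n, modpart n m <> 0.
Proof.
move=> m0; apply: contrapT => H; apply: m0; apply: modpart_eq0 => n.
by apply: contrapT => mn; apply: H; exists n.
Qed.

Lemma schur_scalar (phi : {linear M -> M}) :
  (forall n m, mcomp M n m -> mcomp M n (phi m)) ->
  exists z, forall m, phi m = cscale z m.
Proof.
move=> phiM; have [[m mn0]|M0] := pselect (exists m : M, m <> 0); last first.
  exists 0 => m; rewrite cscale0r; suff -> : m = 0 by apply: linear0.
  by apply: contrapT => m0; apply: M0; exists m.
have [n mn] := exists_homogeneous mn0.
have [||z [w [Mw wn0 phiw]]] := @endo_eigenvector n phi qfM; first exact: phiM.
  by exists (modpart n m); split=> //; apply: modpart_in.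
have phip := modpart_morph (linearD phi) phiM.
exists z => x.
have [||| |H|H] := @graded_simpleP _ _ _ M [set x | phi x = cscale z x] simM.
- by rewrite /= linear0 cscaler0.
- by move=> u v /= u0 v0; rewrite linearD /= u0 v0 cscaleDr.
- by move=> a u /= u0; rewrite linearZ /= u0 scale_cscale.
- move=> k u /= u0; rewrite -phip u0.
  apply: (modpart_morph (f := cscale z)) => [x' y'|i w' Mw']; first exact: cscaleDr.
  by have [_ _] := mcomp_subspace M i; apply.
- by case: wn0; apply: H.
- exact: H.
Qed.

End Eigenvector.

(** * Separating two non-isomorphic graded-simple modules *)

Section Separation.

Variables (C : numClosedFieldType) (Z : zmodType) (A : gradedAlgebra C Z).

Record graded_left_ideal (L : set A) : Prop := GradedLeftIdeal {
  lideal0 : L 0;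
  lidealD : forall a b, L a -> L b -> L (a + b);
  lidealM : forall a b, L b -> L (a * b);
  lideal_algpart : forall k b, L b -> L (algpart k b) }.

Definition annihilator (M : gradedModule A) (S : seq M) : set A :=
  [set b | forall u, u \in S -> b *: u = 0].

Lemma annihilator_ideal (M : gradedModule A) n (S : seq M) :
  (forall u, u \in S -> mcomp M n u) -> graded_left_ideal (annihilator S).
Proof.
move=> Sn; split.
- by move=> u _; rewrite scale0r.
- by move=> a b aS bS u uS; rewrite scalerDl aS // bS // addr0.
- by move=> a b bS u uS; rewrite -scalerA bS // scaler0.
- by move=> k b bS u uS; rewrite -(modpart_scale k b (Sn u uS)) bS //; apply: proj0.
Qed.

Lemma graded_left_idealI (L L' : set A) :
  graded_left_ideal L -> graded_left_ideal L' -> graded_left_ideal (L `&` L').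
Proof.
move=> LI LI'; split.
- by split; apply: lideal0.
- by move=> a b [? ?] [? ?]; split; apply: lidealD.
- by move=> a b [? ?]; split; apply: lidealM.
- by move=> k b [? ?]; split; apply: lideal_algpart.
Qed.

Lemma left_ideal_full (M : gradedModule A) (L : set A) n m : graded_simple M ->
  graded_left_ideal L -> mcomp M n m -> (exists b, L b /\ b *: m <> 0) ->
  forall x, exists b, L b /\ x = b *: m.
Proof.
move=> simM LI Mm [b0 [Lb0 b0m]].
have [||| |H|//] := @graded_simpleP _ _ _ M [set x | exists b, L b /\ x = b *: m] simM.
- by exists 0; rewrite scale0r; split=> //; apply: lideal0.
- move=> _ _ [b [Lb ->]] [c [Lc ->]]; exists (b + c).
  by rewrite scalerDl; split=> //; apply: lidealD.
- by move=> a _ [b [Lb ->]]; exists (a * b); rewrite scalerA; split=> //; apply: lidealM.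
- move=> k _ [b [Lb ->]]; exists (algpart (k - n) b); split; first exact: lideal_algpart.
  by rewrite -(modpart_scale _ _ Mm) subrK.
- by case: b0m; apply: H; exists b0.
Qed.

(** If the elements of [L] that kill [u] also kill [m], then [b u |-> b m] is well defined on
    [L u = N] and identifies [N] with [L m = M]; [phi] is its inverse. *)
Lemma left_ideal_iso (M N : gradedModule A) (L : set A) n m u :
  graded_simple M -> graded_simple N -> graded_left_ideal L -> mcomp M n m -> mcomp N n u ->
  (exists b, L b /\ b *: m <> 0) -> (forall b, L b -> b *: u = 0 -> b *: m = 0) ->
  exists phi : {linear M -> N}, [/\ bijective phi,
    forall k, phi @` mcomp M k = mcomp N k & forall b, L b -> b *: u = phi (b *: m)].
Proof.
move=> simM simN LI Mm Nu [b0 [Lb0 b0m]] um.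
pose T (x : M) (y : N) := exists b, [/\ L b, x = b *: m & y = b *: u].
have [|||||phi [bij comp phiT]] := @graph_iso _ _ _ _ _ simM simN T.
- move=> x y x' y' [b [Lb -> ->]] [c [Lc -> ->]].
  by exists (b + c); rewrite !scalerDl; split=> //; apply: lidealD.
- move=> a x y [b [Lb -> ->]].
  by exists (a * b); rewrite !scalerA; split=> //; apply: lidealM.
- move=> k x y [b [Lb -> ->]]; exists (algpart (k - n) b); split.
  + exact: lideal_algpart.
  + by rewrite -(modpart_scale _ _ Mm) subrK.
  + by rewrite -(modpart_scale _ _ Nu) subrK.
- by exists (b0 *: m), (b0 *: u); split=> //; exists b0.
- by move=> x [b [Lb -> /esym/(um b Lb)]].
- by exists phi; split=> // b Lb; apply: phiT; exists b.
Qed.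

Section TwoModules.

Variables M N : gradedModule A.
Hypotheses (simM : graded_simple M) (simN : graded_simple N).
Hypotheses (qfM : quasifinite M) (qfN : quasifinite N).
Hypothesis notiso : ~ graded_iso M N.
Variable n : Z.

Lemma annihilator_cons (P : gradedModule A) (u : P) S b :
  annihilator S b -> b *: u = 0 -> annihilator (u :: S) b.
Proof. by move=> bS bu v; rewrite inE => /orP[/eqP->|/bS]. Qed.

(** Induction on [T]: if no element of the annihilator of the tail kills [u] but not [m],
    [left_ideal_iso] makes [M] and [N] isomorphic. *)
Lemma separate_other (T : seq N) m : (forall u, u \in T -> mcomp N n u) ->
  mcomp M n m -> m <> 0 -> exists b, annihilator T b /\ b *: m <> 0.
Proof.
move=> + Mm mn0; elim: T => [|u T IH] TN; first by exists 1; rewrite scale1r.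
have TN' v : v \in T -> mcomp N n v by move=> vT; apply: TN; rewrite inE vT orbT.
have uN : mcomp N n u by apply: TN; rewrite mem_head.
apply: contrapT => H; apply: notiso.
have [||phi [bij comp _]] := left_ideal_iso simM simN (annihilator_ideal TN') Mm uN.
- exact: IH.
- move=> b bT bu; apply: contrapT => bm; apply: H; exists b; split=> //.
  exact: annihilator_cons.
- by exists phi.
Qed.

(** The span is given by recursion on the list so that the induction in [separate] peels off one
    vector at a time. *)
Fixpoint in_span (S : seq M) (m : M) : Prop :=
  if S is u :: S' then exists z : C, in_span S' (m - cscale z u) else m = 0.

(** The density theorem, for two modules at once.  If no element of the annihilator [L] of the
    remaining vectors kills [u] but not [m], then [b m |-> b u] is a graded endomorphism of [M],
    hence a nonzero scalar [z]; so [L] kills [m - z^-1 u], against the induction hypothesis. *)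
Lemma separate (S : seq M) (T : seq N) m : (forall u, u \in S -> mcomp M n u) ->
  (forall u, u \in T -> mcomp N n u) -> mcomp M n m -> ~ in_span S m ->
  exists b, (annihilator S `&` annihilator T) b /\ b *: m <> 0.
Proof.
move=> + TN; elim: S m => [|u S IH] m SM Mm mS.
  have [b [bT bm]] := separate_other TN Mm mS.
  by exists b; split=> //; split.
have SM' v : v \in S -> mcomp M n v by move=> vS; apply: SM; rewrite inE vS orbT.
have Mu : mcomp M n u by apply: SM; rewrite mem_head.
have LI := graded_left_idealI (annihilator_ideal SM') (annihilator_ideal TN).
have [b0 [Lb0 b0m]] : exists b, (annihilator S `&` annihilator T) b /\ b *: m <> 0.
  by apply: IH => // H; apply: mS; exists 0; rewrite cscale0r subr0.
apply: contrapT => H.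
have [||phi [[phi' phiK _] comp phib]] := left_ideal_iso simM simM LI Mm Mu.
- by exists b0.
- move=> b [bS bT] bu; apply: contrapT => bm; apply: H; exists b; split=> //.
  by split=> //; apply: annihilator_cons.
have [|z zphi] := @schur_scalar _ _ _ M simM qfM phi.
  by move=> k x Mx; rewrite -comp; exists x.
have z0 : z != 0.
  apply: contra_notN b0m => /eqP z0; apply: (can_inj phiK).
  by rewrite zphi z0 cscale0r linear0.
have [|||b [Lb bmu]] := IH (m - cscale z^-1 u) => //.
- apply: subgroupB Mm _; first exact: mcomp_subgroup.
  by have [_ _] := mcomp_subspace M n; apply.
- by move=> mu; apply: mS; exists z^-1.
apply: bmu; rewrite scalerBr scale_cscale phib // zphi cscaleA mulVf //.
by rewrite cscale1r subrr.
Qed.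

Lemma in_span_fix (S : seq M) (b : A) m :
  (forall u, u \in S -> b *: u = u) -> in_span S m -> b *: m = m.
Proof.
elim: S m => [|u S IH] m bS /=; first by move->; rewrite scaler0.
case=> z /IH H; rewrite -[m](subrK (cscale z u)) scalerDr H => [|v vS].
  by rewrite scale_cscale bS ?mem_head.
by apply: bS; rewrite inE vS orbT.
Qed.

(** Built one vector at a time: if [b] fixes the vectors of [S] and [u] is outside their span, add
    to [b] an element that kills [S] and [T] and sends [u] to the defect [u - b u]. *)
Lemma identity_on_list (S : seq M) (T : seq N) :
  (forall u, u \in S -> mcomp M n u) -> (forall u, u \in T -> mcomp N n u) ->
  exists b, [/\ gcomp A 0 b, forall u, u \in S -> b *: u = u & annihilator T b].
Proof.
move=> + TN; elim: S => [|u S IH] SM.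
  exists 0; split=> //; first exact: (subgroup0 (gcomp_subgroup A 0)).
  exact: (lideal0 (annihilator_ideal TN)).
have SM' v : v \in S -> mcomp M n v by move=> vS; apply: SM; rewrite inE vS orbT.
have Mu : mcomp M n u by apply: SM; rewrite mem_head.
have LI := graded_left_idealI (annihilator_ideal SM') (annihilator_ideal TN).
have [b [b0 bS bT]] := IH SM'.
have [uS|uS] := pselect (in_span S u).
  exists b; split=> // v; rewrite inE => /orP[/eqP->|/bS //].
  exact: in_span_fix bS uS.
have [c [Lc cu]] := left_ideal_full simM LI Mu (separate SM' TN Mu uS) (u - b *: u).
have [c0S c0T] := lideal_algpart LI 0 Lc.
exists (b + algpart 0 c); split.
- apply: subgroupD => //; first exact: gcomp_subgroup.
  exact: proj_in.
- move=> v; rewrite inE scalerDl => /orP[/eqP->|vS]; last first.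
    by rewrite bS // c0S // addr0.
  have Mbu := mcompZ b0 Mu; rewrite add0r in Mbu.
  have {}Mbu := subgroupB (mcomp_subgroup M n) Mu Mbu.
  by rewrite -(modpart_scale 0 c Mu) add0r -cu (modpart_id _ Mbu) eqxx addrC subrK.
- exact: (lidealD (annihilator_ideal TN)).
Qed.

Lemma quasifinite_span (P : gradedModule A) k : quasifinite P ->
  exists S : seq P, (forall u, u \in S -> mcomp P k u) /\
    forall b b' : A, (forall u, u \in S -> b *: u = b' *: u) ->
      forall m, mcomp P k m -> b *: m = b' *: m.
Proof.
move=> /(_ k)[d [e eP]]; exists (codom e); split=> [u /codomP[i ->]|b b' bb' m].
  rewrite eP; exists (fun j => (j == i)%:R).
  rewrite (bigD1 i) //= eqxx big1 ?addr0 ?cscale1r // => j /negPf ->.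
  exact: cscale0r.
rewrite eP => -[c ->]; rewrite !scaler_sumr; apply: eq_bigr => i _.
by rewrite !scale_cscale bb' ?codom_f.
Qed.

Lemma separating_unit : exists b, [/\ gcomp A 0 b,
  forall m, mcomp M n m -> b *: m = m & forall u, mcomp N n u -> b *: u = 0].
Proof.
have [S [SM Sspan]] := quasifinite_span n qfM.
have [T [TN Tspan]] := quasifinite_span n qfN.
have [b [b0 bS bT]] := identity_on_list SM TN; exists b; split=> //.
- by move=> m /Sspan H; rewrite -[RHS]scale1r; apply: H => u /bS ->; rewrite scale1r.
- by move=> u /Tspan H; rewrite -(scale0r u); apply: H => v /bT ->; rewrite scale0r.
Qed.

End TwoModules.

End Separation.

(** * Units of degree zero in the isotypic components *)

Section Inertia.

Variables (C : numClosedFieldType) (Z : zmodType) (A : gradedAlgebra C Z).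
Variables (K : finGroupType) (s : autGroup A K) (M : gradedModule A).
Hypotheses (simM : graded_simple M) (qfM : quasifinite M).

Let L := inertia_group s M.

Lemma autV x a : s x (s x^-1%g a) = a.
Proof. by rewrite -autM mulgV aut1. Qed.

Lemma twisted_simple x : graded_simple (twisted_module (aut_gcomp s x) M).
Proof.
move=> N [N0 ND NZ] gN; apply: (simM (N := N)) => //; split=> // a m Nm.
by rewrite -[a](autV x); apply: NZ.
Qed.

Lemma twisted_quasifinite x : quasifinite (twisted_module (aut_gcomp s x) M).
Proof.
move=> n; have [d [e eM]] := qfM n; exists d, e.
have twE (c : 'I_d -> C) : \sum_i cscale (c i) (e i : twist (s x) M) = \sum_i cscale (c i) (e i).
  by apply: eq_bigr => i _; rewrite twist_cscaleE.
transitivity (mcomp M n); first by [].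
rewrite eM; apply/seteqP; split=> m [c mE]; exists c; first by rewrite twE.
by rewrite mE twE.
Qed.

(** A product of separating units, one for each [x] in [r]: in degree 0 every factor preserves
    [M_n], so a vanishing factor kills the whole product. *)
Lemma noninertia_separation (r : seq K) n : (forall x, x \in r -> x \notin L) ->
  exists b, [/\ gcomp A 0 b, forall m, mcomp M n m -> b *: m = m
    & forall x, x \in r -> forall m, mcomp M n m -> s x b *: m = 0].
Proof.
elim: r => [|x r IH] rL.
  (* The degree 0 part of 1 acts on homogeneous vectors as 1 does. *)
  exists (algpart 0 1); split=> // [|m Mm]; first exact: proj_in.
  by rewrite -(modpart_scale 0 1 Mm) add0r scale1r (modpart_id _ Mm) eqxx.
have [|b [b0 b1 br]] := IH; first by move=> y yr; apply: rL; rewrite inE yr orbT.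
have xL : ~ graded_iso M (twisted_module (aut_gcomp s x) M).
  by move=> iso; have := rL x (mem_head _ _); rewrite inE => /asboolP.
have [c [c0 c1 cx]] := separating_unit simM (@twisted_simple x) qfM (@twisted_quasifinite x) xL n.
have stab y m : mcomp M n m -> mcomp M n (s y b *: m).
  by move=> Mm; have := mcompZ (aut_comp s y b0) Mm; rewrite add0r.
exists (c * b); split.
- by have := gcompM c0 b0; rewrite addr0.
- by move=> m Mm; rewrite -scalerA b1 // c1.
- move=> y; rewrite inE => /orP[/eqP->|yr] m Mm; rewrite rmorphM /= -scalerA.
    by apply: cx; apply: stab.
  by rewrite br // scaler0.
Qed.

(** The isomorphism from [M] to [M^x] carries the action of [b] to that of [s x b], and acting as
    the identity is invariant under conjugation. *)
Lemma inertia_fix x b n : x \in L -> (forall m, mcomp M n m -> b *: m = m) ->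
  forall m, mcomp M n m -> s x b *: m = m.
Proof.
rewrite inE => /asboolP[phi _ phiM] b1 m.
rewrite -[mcomp M n m]/(mcomp (twisted_module (aut_gcomp s x) M) n m).
rewrite -phiM => -[m' Mm' <-]; have /(congr1 phi) := b1 _ Mm'.
by rewrite linearZ /=.
Qed.

(** Averaging the [b] of [noninertia_separation] against [f]: the terms outside the inertia group
    vanish on [M_n], and the others contribute 1 each. *)
Lemma isotypic_unit (f : dual C K) n : restr_dual L f = 0 ->
  exists e, isotypic s 0 f e /\ forall m, mcomp M n m -> e *: m = m.
Proof.
move=> fL; have fx x : x \in L -> f x = 1.
  by move=> xL; have := restr_dualE f (subg L x); rewrite subgK // fL dual0E.
have [|b [b0 b1 bx]] := @noninertia_separation [seq x <- enum K | x \notin L] n.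
  by move=> x; rewrite mem_filter => /andP[].
have L0 : #|L|%:R != 0 :> C by rewrite pnatr_eq0 -lt0n cardG_gt0.
exists ((#|K|%:R / #|L|%:R) *: isoproj s f b); split.
  by have [_ _] := isotypic_subspace s 0 f; apply; apply: isoproj_comp.
move=> m Mm; rewrite /isoproj !cscaleAl scaler_suml.
rewrite (bigID (mem L)) /= [X in _ + X]big1 ?addr0 => [|x xL]; last first.
  by rewrite cscaleAl bx ?cscaler0 // mem_filter xL mem_enum.
have -> : \sum_(x in inertia s M) ((f x)^-1 *: s x b) *: m = cscale #|L|%:R m.
  transitivity (\sum_(x in inertia s M) cscale (1 : C) m).
    by apply: eq_bigr => x xL; rewrite fx // invr1 scale1r cscale1r; apply: inertia_fix b1 _ Mm.
  by rewrite -cscale_suml sumr_const.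
rewrite !cscaleA -mulrA mulrACA mulVf // mulfV ?mulr1 ?cscale1r //.
exact: cardK_neq0.
Qed.

End Inertia.

(** * Coverings for the group and for the inertia group *)

(** By orthogonality, if [h] were not a restriction then all the sums over [L] of the ratios of a
    restricted character to [h] would vanish; but summed over all characters of [K], by the
    orthogonality relation of [K], these ratios give the order of [K]. *)
Lemma restr_dual_surj (C : numClosedFieldType) (K : finGroupType) (L : {group K})
    (h : dual C (subg_of L)) : abelian [set: K]%SET -> exists g : dual C K, restr_dual L g = h.
Proof.
move=> abK; apply: contrapT => nh.
have S0 : \sum_(g : dual C K) \sum_u (restr_dual L g - h) u = 0.
  apply: big1 => g _; rewrite sum_dual subr_eq0.
  by case: eqP => // gh; case: nh; exists g.
have : \sum_(g : dual C K) \sum_u (restr_dual L g - h) u = #|K|%:R.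
  rewrite exchange_big (bigD1 (1%g : subg_of L)) //.
  have -> : \sum_(g : dual C K) (restr_dual L g - h) 1%g = #|K|%:R.
    rewrite -(card_dual C abK) -sumr_const; apply: eq_bigr => g _; exact: dual1.
  apply: etrans (addr0 _); congr (_ + _); apply: big1 => u u1.
  under eq_bigr do rewrite dualDE restr_dualE.
  rewrite -mulr_suml sum_over_dual_neq1 ?mul0r //.
by move/eqP; rewrite S0 eq_sym pnatr_eq0 -cardsT gtn_eqF // cardG_gt0.
Qed.

Section Isotypic.

Variables (C : numClosedFieldType) (Z : zmodType) (A : gradedAlgebra C Z).
Variables (K : finGroupType) (s : autGroup A K).

Lemma isotypic_sumI k f a : isotypic s k f a -> isotypic_sum s f a.
Proof.
move=> fa; exists [:: k], (fun j => if j == k then a else 0); last first.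
  by rewrite big_seq1 eqxx.
move=> j; case: eqP => [->|_] //.
by have [] := isotypic_subspace s j f.
Qed.

(** As [K] is abelian, the projections commute with the group, so they preserve the eigenvalues
    under [L]. *)
Lemma isoproj_restr (L : {group K}) (h : dual C (subg_of L)) f a :
  (forall u, restr_aut s L u a = h u *: a) -> restr_dual L f <> h -> isoproj s f a = 0.
Proof.
move=> ha fh; apply: contrapT => a0; apply: fh; apply: dualP => u; rewrite restr_dualE.
have comm : isoproj s f (s (sgval u) a) = s (sgval u) (isoproj s f a).
  rewrite /isoproj [RHS]linearZ /= [in RHS]linear_sum; congr (_ *: _); apply: eq_bigr => x _.
  rewrite linearZ /= -!autM; congr (_ *: s _ a).
  by have /centsP := aut_abelian s; apply; rewrite inE.
move: comm; rewrite isoproj_act [s _ a]ha linearZ /= => /eqP.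
by rewrite -subr_eq0 -scalerBl scaler_eq0 subr_eq0 => /orP[/eqP|/eqP/a0].
Qed.

Lemma isotypic_restr (L : {group K}) k f a :
  isotypic s k f a -> isotypic (restr_aut s L) k (restr_dual L f) a.
Proof. by case=> ka fa; split=> // u; rewrite restr_dualE -fa. Qed.

Lemma isotypic_sum_restr (L : {group K}) f a :
  isotypic_sum s f a -> isotypic_sum (restr_aut s L) (restr_dual L f) a.
Proof. by case=> r [x xf ->]; exists r, x => // k; apply: isotypic_restr. Qed.

End Isotypic.

Section Coverings.

Variables (C : numClosedFieldType) (Z : zmodType) (A : gradedAlgebra C Z).
Variables (K : finGroupType) (s : autGroup A K) (M : gradedModule A).
Hypotheses (simM : graded_simple M) (qfM : quasifinite M).

Let L := inertia_group s M.
Let H := restr_aut s L.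
Let psi : dual C K -> dual C _ := restr_dual L.

(** Decompose [a] under the big group and multiply each part on the right by a unit that moves its
    character to [g] while fixing [M_n]. *)
Lemma rho_isotypic (g : dual C K) (n k : Z) :
  rho M n @` isotypic s (k - n) g = rho M n @` isotypic H (k - n) (psi g).
Proof.
apply/seteqP; split=> [_ [a ga <-]|_ [a [ka ga] <-]].
  by exists a => //; apply: isotypic_restr.
have /choice[e eP] : forall f : dual C K, exists e, psi f = psi g -> 
    isotypic s 0 (g - f) e /\ forall m, mcomp M n m -> e *: m = m.
  move=> f; have [fg|fg] := pselect (psi f = psi g); last by exists 0.
  have [|e eP] := isotypic_unit simM qfM (s := s) (f := g - f) n; last by exists e.
  by rewrite raddfB /= [restr_dual _ f]fg subrr.
exists (\sum_(f | `[< psi f = psi g >]) isoproj s f a * e f).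
  apply: (subspace_sum (isotypic_subspace s (k - n) g)) => f /asboolP fg.
  rewrite -[k - n]addr0 -[g](subrK f) [g - f + f]addrC; apply: isotypicM.
    exact: isoproj_comp.
  by have [] := eP f fg.
apply: funext => -[m mM]; rewrite /rho /= scaler_suml.
have Mm : mcomp M n m by apply: set_mem.
rewrite -[X in _ = X *: _](isoproj_sum s a) [in RHS](bigID (fun f => `[< psi f = psi g >])) /=.
rewrite [X in _ = (_ + X) *: _]big1 ?addr0 => [|f /asboolPn]; last exact: isoproj_restr.
rewrite scaler_suml; apply: eq_bigr => f /asboolP fg; rewrite -scalerA.
by have [_ ->] := eP f fg.
Qed.

Lemma covering_subgroup (F : finGroupType) (t : autGroup A F) (W : dual C F -> set M) :
  covering t W -> forall f, subgroup (W f).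
Proof. by case=> cW _ _ f; apply/subspace_subgroup; have [] := cW f. Qed.

(** A unit with character [f' - f] maps [W f] into [W f'] and is the identity on [M_n]. *)
Lemma covering_constant (W : dual C K -> set M) g g' :
  covering s W -> psi g = psi g' -> W g = W g'.
Proof.
move=> covW; have sW := covering_subgroup covW; case: covW => cW _ WZ.
suff sub f f' : psi f = psi f' -> W f `<=` W f'.
  by move=> gg'; apply/seteqP; split; apply: sub.
move=> ff' m Wm; have [_ /(_ m Wm)[r [x xW ->]]] := cW f.
apply: subgroup_sum => // n _ _; have [Wx Mx] := xW n.
have [|e [fe en]] := isotypic_unit simM qfM (s := s) (f := f' - f) n.
  by rewrite raddfB /= [restr_dual _ f]ff' subrr.
rewrite -(en _ Mx) -(subrK f f'); apply: WZ => //; exact: isotypic_sumI fe.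
Qed.

Lemma covering_inflate (W : dual C _ -> set M) :
  covering H W -> covering s (fun g => W (psi g)).
Proof.
case=> cW spW WZ; split=> [g||f f' a m fa].
- exact: cW.
- move=> m; have [r [x xW ->]] := spW m.
  have /choice[q qP] : forall h, exists g, psi g = h.
    by move=> h; apply: restr_dual_surj (aut_abelian s).
  exists (map q r), (fun g => x (psi g)); first by move=> g; apply: xW.
  by rewrite big_map; apply: eq_bigr => h _; rewrite qP.
- rewrite /psi raddfD; apply: WZ; exact: isotypic_sum_restr.
Qed.

Variable q : dual C (subg_of L) -> dual C K.
Hypothesis qK : cancel q psi.

(** The part of [a] with a character [f] above [h] sends [W (q h')] to the member of index
    [f + q h'], which lies in the same fibre as [q (h + h')]. *)
Lemma covering_deflate (W : dual C K -> set M) :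
  covering s W -> covering H (fun h => W (q h)).
Proof.
move=> covW; have sW := covering_subgroup covW; have [cW spW WZ] := covW.
split=> [g||h h' a m ha Wm].
- exact: cW.
- move=> m; have [r [x xW ->]] := spW m.
  exists (enum {: dual C (subg_of L)}), (fun h => \sum_(g <- r | psi g == h) x g).
    move=> h; apply: subgroup_sum => // g _ /eqP gh.
    by rewrite (covering_constant (g' := g)) // qK.
  rewrite big_enum /= (exchange_big_dep xpredT) //=.
  by apply: eq_bigr => g _; rewrite (big_pred1 (psi g)) // => h; rewrite eq_sym.
- rewrite -(isoproj_sum s a) scaler_suml; apply: subgroup_sum => // f _ _.
  have [fh|fh] := pselect (psi f = h); last first.
    rewrite (isoproj_restr _ fh); first by rewrite scale0r; apply: subgroup0.
    exact: isotypic_sum_eig.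
  rewrite (covering_constant (g' := f + q h')) //.
    by apply: WZ => //; apply: isoproj_in.
  by rewrite qK /psi raddfD /= [restr_dual _ f]fh [restr_dual _ (q h')]qK.
Qed.

Lemma thin_inflate (W : dual C _ -> set M) :
  thin H W -> thin s (fun g => W (psi g)).
Proof.
case=> covW minW; split=> [|N covN NW g]; first exact: covering_inflate.
rewrite -(minW _ (covering_deflate covN)); last by move=> h m /NW; rewrite qK.
by apply: covering_constant; rewrite ?qK.
Qed.

Lemma thin_deflate (W : dual C K -> set M) :
  thin s W -> thin H (fun h => W (q h)).
Proof.
case=> covW minW; split=> [|N covN NW h]; first exact: covering_deflate.
rewrite -(minW _ (covering_inflate covN)); first by rewrite qK.
by move=> g m /NW; rewrite (covering_constant (g' := g)) ?qK.
Qed.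

End Coverings.

Lemma thin_bijection (C : numClosedFieldType) (Z : zmodType) (A : gradedAlgebra C Z)
    (K : finGroupType) (s : autGroup A K) (M : gradedModule A) :
  graded_simple M -> quasifinite M ->
  let H := restr_aut s (inertia_group s M) in
  let psi : dual C K -> dual C _ := restr_dual (inertia_group s M) in
  set_bij [set W : dual C _ -> set M | thin H W] [set W : dual C _ -> set M | thin s W]
    (fun W g => W (psi g)).
Proof.
move=> simM qfM H psi; have /choice[q qK] : forall h, exists g, psi g = h.
  by move=> h; apply: restr_dual_surj (aut_abelian s).
split=> [W|W W' _ _ WW'|W thinW] /=.
- exact: (thin_inflate simM qfM qK).
- by apply: funext => h; rewrite -(qK h); apply: (congr1 (@^~ (q h)) WW').
- exists (fun h => W (q h)); first exact: thin_deflate.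
  by apply: funext => g; apply: (covering_constant simM qfM (thin_covering thinW)); apply: qK.
Qed.

(** * Simplicity of the external sum of a thin covering *)

Lemma shift_simple (C : numClosedFieldType) (Z : zmodType) (A : gradedAlgebra C Z)
    (M : gradedModule A) (d : Z) : graded_simple M -> graded_simple (shift d M).
Proof.
move=> simM N sN gN; apply: (simM N) => // m Nm.
have [r [x xN ->]] := gN m Nm; exists [seq n + d | n <- r], (fun n => x (n - d)).
  by move=> n; have := xN (n - d); rewrite /= subrK.
by rewrite big_map; apply: eq_bigr => n _; rewrite addrK.
Qed.

Section ExtSimple.

Variables (C : numClosedFieldType) (Z : zmodType) (A : gradedAlgebra C Z).
Variables (K : finGroupType) (s : autGroup A K) (M : gradedModule A).
Hypothesis simM : graded_simple M.
Variable W : dual C K -> set M.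
Hypothesis thinW : thin s W.

Let covW := thin_covering thinW.

(** The components [N' f] of a graded submodule [N] span a graded submodule of [M].  If it is zero,
    so is [N]; otherwise the [N' f] form a covering, equal to [W] by thinness, and then [N]
    contains every homogeneous element of the external sum. *)
Lemma ext_module_simple : graded_simple (ext_module covW).
Proof.
move=> N [N0 ND NZ] gN; have sN : subgroup N.
  by split=> // x y Nx Ny; apply: ND => //; rewrite -scaleN1r; apply: NZ.
have cN c p : N p -> N (cscale c p) by move=> Np; apply: NZ.
pose N' (f : dual C K) : set M := [set m | exists p : ext_sum covW, N p /\ m = p f].
have N'W f : N' f `<=` W f by move=> _ [p [_ ->]]; apply: ext_in.
have sN' f : subspace (@cscale C A M) (N' f).
  split.
  - by exists 0; rewrite ext_zeroE.
  - move=> _ _ [p [Np ->]] [p' [Np' ->]]; exists (p + p').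
    by rewrite ext_addE; split=> //; apply: ND.
  - move=> c _ [p [Np ->]]; exists (cscale c p).
    by rewrite ext_cscaleE; split=> //; apply: cN.
have N'sub f := subspace_subgroup (sN' f).
have N'n f n : subgroup (N' f `&` mcomp M n).
  split=> [|x y [Nx Mx] [Ny My]]; split.
  - exact: subgroup0.
  - by have [] := mcomp_subspace M n.
  - exact: subgroupB.
  - by apply: (subgroupB (mcomp_subgroup M n)).
have gN' f : is_graded (N' f).
  move=> _ [p [Np ->]]; have [r [x xN ->]] := gN p Np; rewrite ext_sumE.
  apply: (subgroup_sum (sum_set_subgroup (N'n f))) => -[n f'] _ _.
  have [Nx [/= Mx x0]] := xN (n, f').
  have [ff'|ff'] := eqVneq f f'; last first.
    by rewrite x0 //; apply: (subgroup0 (sum_set_subgroup (N'n f))).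
  by apply: (sum_setI (N'n f) (i := n)); split; [exists (x (n, f')) | rewrite ff'].
have actN' f f' a m : isotypic_sum s f a -> N' f' m -> N' (f + f') (a *: m).
  move=> fa [p [Np ->]]; exists (a *: p); split; first exact: NZ.
  transitivity (a *: p (f + f' - f)); first by rewrite addrC addKr.
  by apply/esym/ext_scale_eig/isotypic_sum_eig.
have sT := sum_set_subgroup N'sub.
have [||| |zero|full] := @graded_simpleP _ _ _ M (sum_set N') simM.
- exact: (subgroup0 sT).
- by move=> x y; apply: (subgroupD sT).
- move=> a m [r [x xN ->]]; rewrite scaler_sumr.
  apply: (subgroup_sum sT) => f _ _; rewrite -(isoproj_sum s a) scaler_suml.
  apply: (subgroup_sum sT) => g _ _; apply: (sum_setI N'sub (i := g + f)).
  by apply: actN' => //; apply: isoproj_in.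
- move=> n m [r [x xN ->]]; rewrite modpart_sum; apply: (subgroup_sum sT) => f _ _.
  by apply: (sum_setI N'sub (i := f)); apply: is_graded_modpart.
- left; apply/seteqP; split=> [p Np|_ ->//].
  apply: ext_eqP => f; rewrite ext_zeroE; apply: zero.
  by apply: (sum_setI N'sub (i := f)); exists p.
- right; suff full' (p : ext_sum covW) : N p by apply/seteqP; split=> // p _; apply: full'.
  have N'E f : N' f = W f.
    have [_ minW] := thinW; apply: minW => //; split.
  have /choice[q qP] : forall f, exists q : ext_sum covW, N q /\ p f = q f.
    by move=> f; have := ext_in p f; rewrite -N'E.
  (* An element of [N] with f-component [p f] exists by [N'E]; as [N] is graded for the dual, its
     homogeneous part of index [f] is again in [N]. *)
  have single f : exists u, N u /\ u = ext_single covW (ext_in p f).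
    exists (ext_single covW (ext_in p f)); split=> //.
    have [Nq pq] := qP f; have [r [x xN qE]] := gN _ Nq.
    suff -> : ext_single covW (ext_in p f) = \sum_(nf <- r | nf.2 == f) x nf.
      by apply: subgroup_sum => // nf _ _; have [] := xN nf.
    apply: ext_eqP => h; rewrite ext_singleE ext_sumE; case: eqP => [->|hf].
      rewrite pq qE ext_sumE [LHS](bigID (fun nf => nf.2 == f)) /=.
      rewrite [X in _ + X]big1 ?addr0 // => nf nff.
      by have [_ [_]] := xN nf; apply; rewrite eq_sym.
    rewrite big1 // => nf /eqP nff; have [_ [_]] := xN nf; apply.
    by rewrite nff; apply/eqP.
  suff -> : p = \sum_f ext_single covW (ext_in p f).
    by apply: subgroup_sum => // f _ _; have [u [Nu <-]] := single f.
  apply: ext_eqP => h; rewrite ext_sumE.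
  transitivity (\sum_f if f == h then p h else 0).
    by rewrite -big_mkcond big_pred1_eq.
  by apply: eq_bigr => f _; rewrite ext_singleE eq_sym; case: eqP => // ->.
Qed.

End ExtSimple.

(** * Uniqueness of the external sum *)

Section Evaluation.

Variables (C : numClosedFieldType) (Z : zmodType) (A : gradedAlgebra C Z).
Variables (K : finGroupType) (s : autGroup A K) (M : gradedModule A).
Variable W : dual C K -> set M.
Hypothesis covW : covering s W.

Implicit Types p q : ext_sum covW.

(** For [x = 1] this is the canonical map to [M]; for general [x] it is a homomorphism to the
    twisted module [M^x], by [eval_dualZ]. *)
Definition eval_dual (x : K) p : M := \sum_(f : dual C K) cscale (f x) (p f).

Lemma eval_dualD x p q : eval_dual x (p + q) = eval_dual x p + eval_dual x q.
Proof. by rewrite -big_split; apply: eq_bigr => f _; rewrite ext_addE cscaleDr. Qed.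

Lemma eval_dualB x p q : eval_dual x (p - q) = eval_dual x p - eval_dual x q.
Proof. by apply/eqP; rewrite eq_sym subr_eq -eval_dualD subrK. Qed.

Lemma eval_dualZ x (a : A) p : eval_dual x (a *: p) = s x a *: eval_dual x p.
Proof.
have -> : s x a = \sum_(f : dual C K) f x *: isoproj s f a.
  rewrite -{1}(isoproj_sum s a) linear_sum; apply: eq_bigr => f _.
  exact: isoproj_act.
rewrite scaler_suml.
transitivity (\sum_(h : dual C K) \sum_(f : dual C K) cscale (h x) (isoproj s f a *: p (h - f))).
  by apply: eq_bigr => h _; rewrite ext_scaleE cscale_sumr.
rewrite exchange_big; apply: eq_bigr => f _ /=.
rewrite (reindex_inj (addIr f)) cscaleAl scaler_sumr cscale_sumr /=.
by apply: eq_bigr => g _; rewrite addrK dualDE scale_cscale cscaleA mulrC.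
Qed.

(** Fourier inversion on the dual group. *)
Lemma eval_dual_separates p : (forall x, eval_dual x p = 0) -> p = 0.
Proof.
move=> p0; apply: ext_eqP => f; rewrite ext_zeroE.
have : \sum_x cscale (f x)^-1 (eval_dual x p) = cscale #|K|%:R (p f).
  transitivity (\sum_(g : dual C K) \sum_x cscale ((g - f) x) (p g)).
    rewrite exchange_big; apply: eq_bigr => x _; rewrite cscale_sumr.
    by apply: eq_bigr => g _; rewrite cscaleA dualDE dualNE mulrC.
  transitivity (\sum_g if g == f then cscale #|K|%:R (p f) else 0).
    apply: eq_bigr => g _; rewrite -cscale_suml sum_dual subr_eq0.
    by case: eqP => [->//|_]; rewrite cscale0r.
  by rewrite -big_mkcond big_pred1_eq.
rewrite big1 => [/(congr1 (cscale (#|K|%:R)^-1))|x _]; last by rewrite p0 cscaler0.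
by rewrite cscaler0 cscaleA mulVf ?cscale1r ?cardK_neq0.
Qed.

Lemma ext_modpart_proof n p : [ffun f => modpart n (p f)] \in ext_pred covW.
Proof.
apply/asboolP => f; rewrite ffunE; have [cW _ _] := covW; have [sW gW] := cW f.
by apply: is_graded_modpart (ext_in p f) => //; apply: subspace_subgroup.
Qed.

Definition ext_modpart n p : ext_sum covW := ExtSum (ext_modpart_proof n p).

Lemma ext_modpartE n p f : ext_modpart n p f = modpart n (p f).
Proof. by rewrite ffunE. Qed.

Lemma eval_dual_modpart x n p : eval_dual x (ext_modpart n p) = modpart n (eval_dual x p).
Proof.
rewrite modpart_sum; apply: eq_bigr => f _; rewrite ext_modpartE.
rewrite (modpart_morph (f := cscale (f x))) // => [u v|k u Mu]; first exact: cscaleDr.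
by have [_ _] := mcomp_subspace M k; apply.
Qed.

(** [S] is maximal among the sets of evaluations with a nonzero common kernel, and [x0] is any
    evaluation not vanishing on that kernel; by maximality no nonzero vector of the kernel is
    killed by [x0] as well. *)
Lemma isolating_set : (exists p, p <> 0) -> exists (S : {set K}) (x0 : K),
  (exists p, p <> 0 /\ forall x, x \in S -> eval_dual x p = 0) /\
  forall p, (forall x, x \in S -> eval_dual x p = 0) -> eval_dual x0 p = 0 -> p = 0.
Proof.
move=> [p0 p0n0].
pose P (S : {set K}) := `[< exists p, p <> 0 /\ forall x, x \in S -> eval_dual x p = 0 >].
have [|S /maxsetP[/asboolP[p [pn0 Sp]] maxS]] := @ex_maxset _ P.
  by exists finset.set0; apply/asboolP; exists p0; split=> // x; rewrite inE.
have [x0 px0] : exists x0, eval_dual x0 p <> 0.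
  apply: contrapT => H; apply: pn0; apply: eval_dual_separates => x.
  by apply: contrapT => px; apply: H; exists x.
exists S, x0; split; first by exists p.
move=> q qS qx0; apply: contrapT => qn0; apply: px0; apply: Sp.
rewrite -(maxS (x0 |: S)%SET) ?setU11 ?finset.subsetUr //.
apply/asboolP; exists q; split=> // x; rewrite !inE => /orP[/eqP->//|]; exact: qS.
Qed.

Hypothesis simM : graded_simple M.

(** The evaluation at [x0] is injective on the common kernel [X] of [isolating_set], and onto by
    simplicity of [M]; [th] is the inverse bijection, an embedding of [M^x0] in the external
    sum. *)
Lemma twisted_section : (exists p, p <> 0) ->
  exists (x0 : K) (th : M -> ext_sum covW),
  [/\ forall u v, th (u + v) = th u + th v,
      forall (a : A) u, th (s x0 a *: u) = a *: th u,
      forall n u f, mcomp M n u -> mcomp M n (th u f) &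
      forall u, eval_dual x0 (th u) = u].
Proof.
move=> /isolating_set[S [x0 [[p [pn0 Sp]] Sx0]]]; exists x0.
pose X q := forall x, x \in S -> eval_dual x q = 0.
have XD q q' : X q -> X q' -> X (q + q').
  by move=> Xq Xq' x xS; rewrite eval_dualD Xq // Xq' // addr0.
have XZ (a : A) q : X q -> X (a *: q).
  by move=> Xq x xS; rewrite eval_dualZ Xq // scaler0.
have Xpart n q : X q -> X (ext_modpart n q).
  by move=> Xq x xS; rewrite eval_dual_modpart Xq //; apply: proj0.
have injX q q' : X q -> X q' -> eval_dual x0 q = eval_dual x0 q' -> q = q'.
  move=> Xq Xq' qq'; apply/eqP; rewrite -subr_eq0; apply/eqP/Sx0 => [x xS|].
    by rewrite eval_dualB Xq // Xq' // subrr.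
  by rewrite eval_dualB qq' subrr.
have onto u : exists q, X q /\ eval_dual x0 q = u.
  have [||| |H|full] := @graded_simpleP _ _ _ M [set u | exists q, X q /\ eval_dual x0 q = u] simM.
  - exists 0; split=> [x _|]; rewrite /eval_dual big1 // => f _; rewrite ext_zeroE; exact: cscaler0.
  - by move=> _ _ [q [Xq <-]] [q' [Xq' <-]]; exists (q + q'); split; [apply: XD|apply: eval_dualD].
  - move=> a _ [q [Xq <-]]; exists (s x0^-1%g a *: q); split; first exact: XZ.
    by rewrite eval_dualZ autV.
  - move=> n _ [q [Xq <-]]; exists (ext_modpart n q).
    by split; [apply: Xpart | apply: eval_dual_modpart].
  - by case: pn0; apply: Sx0 => //; apply: H; exists p.
  - exact: full u.
have [th thP] := choice onto; have thX u : X (th u) by have [] := thP u.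
have thK u : eval_dual x0 (th u) = u by have [] := thP u.
exists th; split=> //.
- by move=> u v; apply: injX; rewrite ?eval_dualD ?thK //; apply: XD.
- by move=> a u; apply: injX; rewrite ?eval_dualZ ?thK //; apply: XZ.
- move=> n u f Mu; have -> : th u = ext_modpart n (th u).
    by apply: injX => //; [apply: Xpart | rewrite eval_dual_modpart thK (modpart_id _ Mu) eqxx].
  by rewrite ext_modpartE; apply: modpart_in.
Qed.

Lemma ext_nonzero : (exists m : M, m <> 0) -> exists p, p <> 0.
Proof.
move=> [m mn0]; apply: contrapT => H; apply: mn0; have [_ sp _] := covW.
have [r [x xW ->]] := sp m; apply: big1 => f _.
apply: contrapT => xf; apply: H; exists (ext_single covW (xW f)) => e0.
by apply: xf; have := ext_singleE covW (xW f) f; rewrite e0 ext_zeroE eqxx.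
Qed.

End Evaluation.

Section ExtIso.

Variables (C : numClosedFieldType) (Z : zmodType) (A : gradedAlgebra C Z).
Variables (K : finGroupType) (s : autGroup A K) (M : gradedModule A).
Hypothesis simM : graded_simple M.
Variables W W' : dual C K -> set M.
Hypotheses (thinW : thin s W) (thinW' : thin s W').

Let covW := thin_covering thinW.
Let covW' := thin_covering thinW'.

Section Component.

Variables (x0 : K) (th : M -> ext_sum covW') (g : dual C K).
Hypotheses (thD : forall u v, th (u + v) = th u + th v)
  (thZ : forall (a : A) u, th (s x0 a *: u) = a *: th u).

Lemma degree_part_proof (p : ext_sum covW) :
  [ffun h : dual C K => cscale ((h - g) x0) (th (p (h - g)) h)] \in ext_pred covW'.
Proof. by apply/asboolP => h; rewrite ffunE; apply: coveringZ covW' _ _ _ _; apply: ext_in. Qed.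

(** The part of degree [g], with respect to the dual, of the composite of [eval_dual x0] with [th]:
    on the summand of index [f], the evaluation is the scalar [f x0], and [h - g] is the index
    of the summand sent into the one of index [h]. *)
Definition degree_part (p : ext_sum covW) : ext_sum covW' := ExtSum (degree_part_proof p).

Lemma degree_partE p h : degree_part p h = cscale ((h - g) x0) (th (p (h - g)) h).
Proof. by rewrite ffunE. Qed.

Lemma th_sum (I : Type) (r : seq I) (u : I -> M) :
  th (\sum_(i <- r) u i) = \sum_(i <- r) th (u i).
Proof.
apply: big_morph; first exact: thD.
by apply: (addrI (th 0)); rewrite -thD !addr0.
Qed.

Lemma degree_part_linear : linear degree_part.
Proof.
move=> a p p'; apply: ext_eqP => h.
rewrite [RHS]ext_addE !degree_partE ext_addE thD ext_addE cscaleDr; congr (_ + _).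
have -> : (a *: p) (h - g) = \sum_f isoproj s f a *: p (h - g - f) := ext_scaleE a p _.
have -> : (a *: degree_part p) h = \sum_f isoproj s f a *: degree_part p (h - f) :=
  ext_scaleE a _ _.
rewrite th_sum ext_sumE cscale_sumr; apply: eq_bigr => f _.
rewrite degree_partE scale_cscale [h - f - g]addrAC.
set u := p _; set c := h - g - f.
have fa x : s x (isoproj s f a) = f x *: isoproj s f a by apply: isoproj_act.
have -> : isoproj s f a *: u = s x0 ((f x0)^-1 *: isoproj s f a) *: u.
  by rewrite linearZ /= fa scalerA mulVf ?dual_neq0 // scale1r.
rewrite thZ (@ext_scale_eig _ _ _ _ _ _ _ _ _ _ f) => [|x]; last first.
  by rewrite linearZ /= fa !scalerA [(f x0)^-1 * _]mulrC.
by rewrite cscaleAl cscaleA /c [(h - g - f) x0]dualDE dualNE.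
Qed.

End Component.

Lemma ext_module_iso : exists g : dual C K,
  graded_iso (ext_module covW) (shift (0, g) (ext_module covW')).
Proof.
have [[m mn0]|M0] := pselect (exists m : M, m <> 0); last first.
  have m0 (m : M) : m = 0 by apply: contrapT => mn0; apply: M0; exists m.
  (* For [M = 0] both external sums vanish and the zero map is an isomorphism. *)
  exists 0; pose phi : {linear ext_module covW -> shift (0, 0) (ext_module covW')} := \0.
  have q0 (q : ext_sum covW') : q = 0 by apply: ext_eqP => f; rewrite [LHS]m0 [RHS]m0.
  have p0 (p : ext_sum covW) : p = 0 by apply: ext_eqP => f; rewrite [LHS]m0 [RHS]m0.
  exists phi; first by exists (fun=> 0) => x; [rewrite [RHS]p0|rewrite [RHS]q0].
  move=> n; apply/seteqP; split=> [_ [p _ <-]|q _].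
    by apply: (subgroup0 (mcomp_subgroup (shift _ _) n)).
  exists 0; last by rewrite [RHS]q0 [LHS]q0.
  exact: (subgroup0 (mcomp_subgroup _ n)).
have [|x0 [th [thD thZ thM thK]]] := twisted_section (covW := covW') simM.
  by apply: ext_nonzero; exists m.
have [p pn0] : exists p : ext_sum covW, p <> 0 by apply: ext_nonzero; exists m.
have [f pf] : exists f, p f <> 0.
  apply: contrapT => H; apply: pn0; apply: ext_eqP => f; rewrite ext_zeroE.
  by apply: contrapT => pf; apply: H; exists f.
have [h thh] : exists h, th (p f) h <> 0.
  apply: contrapT => H; apply: pf; rewrite -(thK (p f)); apply: big1 => h _.
  have -> : th (p f) h = 0 by apply: contrapT => E; apply: H; exists h.
  exact: cscaler0.
(* This shift makes the part of degree [g] nonzero on the component [p f]. *)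
pose g := h - f; exists g.
have lin := @degree_part_linear x0 th g thD thZ.
pose phi : {linear ext_module covW -> shift (0, g) (ext_module covW')} :=
  HB.pack (degree_part x0 th g) (GRing.isLinear.Build _ _ _ _ (degree_part x0 th g) lin).
have phiE q k : phi q k = cscale ((k - g) x0) (th (q (k - g)) k) by apply: degree_partE.
have th0 : th 0 = 0 by apply: (addrI (th 0)); rewrite -thD !addr0.
apply: (@schur_iso _ _ _ _ _ _ _ phi).
- exact: ext_module_simple.
- exact/shift_simple/ext_module_simple.
- move=> [n d] q [/= Mq q0]; split=> [|k /= kd]; rewrite phiE /=.
    rewrite addr0 addrK; have [_ _ MZ] := mcomp_subspace M n; apply: MZ.
    exact: thM.
  by rewrite q0 ?subr_eq // th0 ext_zeroE cscaler0.
- exists p => E; apply: thh; have := phiE p h; rewrite E ext_zeroE /g subKr.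
  move/(congr1 (cscale (f x0)^-1)); rewrite cscaler0 cscaleA mulVf ?dual_neq0 //.
  by rewrite cscale1r.
Qed.

End ExtIso.

Theorem theorem4p4 (R : realType) (Z : zmodType) (A : gradedAlgebra R[i] Z)
    (M : gradedModule A) (gT : finGroupType) (Ghat : autGroup A gT) :
  graded_simple M -> quasifinite M ->
  let Hhat := restr_aut Ghat (inertia_group Ghat M) in
  let psi : dual R[i] gT -> dual R[i] _ := restr_dual (inertia_group Ghat M) in
  [/\ forall (g : dual R[i] gT) (n k : Z),
        rho M n @` isotypic Ghat (k - n) g =
        rho M n @` isotypic Hhat (k - n) (psi g),
      set_bij [set W : dual R[i] _ -> set M | thin Hhat W]
              [set W : dual R[i] _ -> set M | thin Ghat W]
              (fun W g => W (psi g)),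
      forall (W : dual R[i] gT -> set M) (thinW : thin Ghat W),
        graded_simple (ext_module (thin_covering thinW))
    & forall (W W' : dual R[i] gT -> set M)
             (thinW : thin Ghat W) (thinW' : thin Ghat W'),
        exists g : dual R[i] gT,
          graded_iso (ext_module (thin_covering thinW))
            (shift (0, g) (ext_module (thin_covering thinW')))].
Proof.
move=> simM qfM Hhat psi; split.
- by move=> g n k; apply: rho_isotypic.
- exact: thin_bijection.
- by move=> W thinW; apply: ext_module_simple.
- by move=> W W' thinW thinW'; apply: ext_module_iso.
Qed.
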